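(* For each positive integer $n$ let $D_n$ be the divisibility relation graph of $n$ and let $f_n$ be the characteristic polynomial of (the adjacency matrix of) $D_n$. The following hold for every positive integer $n$. (1) $D_n$ is a planar graph if and only if there exist distinct primes $p,q$ such that $n \in \{1, p, p^2, p^3, pq, p^2q\}$. (2) Let $p,q$ be two distinct primes such that $\gcd(n,pq)=1$. Then $f_n \mid f_{npq}$. Furthermore, if there exists a prime $r$ such that $r \mid n$ and $r^2 \nmid n$, then $f_n^2 \mid f_{npq}$. (3) If $n \geq 2$, then $-1$ is an eigenvalue of $D_n$. (4) Suppose that $\mu(n)=-1$ and $\Omega(n)\geq 2$. Then $-2$ and $1$ are both eigenvalues of $D_n$. (5) Suppose that $\mu(n)=1$. Then $0$ is an eigenvalue of $D_n$. (6) Suppose that $n=pq^a$ where $p,q$ are distinct primes and $a\geq 1$ is an integer. Then $0$ is an eigenvalue of $D_n$ if and only if $a \equiv 1 \pmod 6$. (7) Suppose that $n=p^aq^b$ where $p,q$ are distinct primes and $a,b\geq 1$ are integers. If $a\equiv b\equiv 1 \pmod 6$, then $0$ is an eigenvalue of $D_n$.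
   Context: For a positive integer $n$, the divisibility relation graph $D_n$ is the simple undirected graph whose vertex set is the set of all positive divisors of $n$, in which two vertices $a\neq b$ are adjacent if and only if $a\mid b$ or $b\mid a$. Eigenvalues and the characteristic polynomial $f_n(\lambda)=\det(A-\lambda I)\in\mathbb{Z}[\lambda]$ of $D_n$ are those of its adjacency matrix $A$; divisibility is in the polynomial ring. $\mu$ is the Möbius function, and $\Omega(n)=\sum_i a_i$ for $n=\prod_i p_i^{a_i}$ is the number of prime factors of $n$ counted with multiplicity. *)

(* Defs.v *)
From mathcomp Require Import all_boot all_order all_algebra.
From mathcomp Require Import boolp classical_sets reals topology normedtype.

Set Implicit Arguments.
Unset Strict Implicit.
Unset Printing Implicit Defensive.

Import Order.TTheory GRing.Theory Num.Theory.
Import numFieldNormedType.Exports.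

Local Open Scope classical_set_scope.
Local Open Scope ring_scope.

Record sgraph := SGraph {
  vertex :> finType;
  adj : rel vertex;
  adj_sym : symmetric adj;
  adj_irrefl : irreflexive adj }.

(* Planarity in the topological sense.  The edge {x, y} is drawn as a simple
   arc, given both as [arc x y] and, traversed backwards, as [arc y x]. *)
Record planar_drawing (R : realType) (G : sgraph)
    (pt : G -> R * R) (arc : G -> G -> R -> R * R) : Prop := PlanarDrawing {
  pt_inj : injective pt;
  arc_continuous : forall x y, adj x y ->
    {within `[0, 1], continuous (arc x y)};
  arc_inj : forall x y, adj x y -> {in `[0, 1] &, injective (arc x y)};
  arc_start : forall x y, adj x y -> arc x y 0 = pt x;
  arc_end : forall x y, adj x y -> arc x y 1 = pt y;
  arc_rev : forall x y, adj x y ->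
    {in `[0, 1], forall t, arc y x t = arc x y (1 - t)};
  arc_avoids_pt : forall x y z, adj x y ->
    {in `]0, 1[, forall t, arc x y t != pt z};
  arc_disjoint : forall x y u v, adj x y -> adj u v ->
    [set x; y]%SET != [set u; v]%SET ->
    {in `]0, 1[ &, forall s t, arc x y s != arc u v t} }.

Definition planar (R : realType) (G : sgraph) : Prop :=
  exists (pt : G -> R * R) (arc : G -> G -> R -> R * R),
    planar_drawing pt arc.

Definition adjmx (S : pzSemiRingType) (G : sgraph) : 'M[S]_#|G| :=
  \matrix_(i, j) (adj (enum_val i) (enum_val j))%:R.

(* This is det(A - X I), which differs from [char_poly] by the sign
   (-1) ^ #|G|. *)
Definition graph_poly (G : sgraph) : {poly int} :=
  \det (map_mx polyC (adjmx int G) - 'X%:M).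

(* Divisibility in Z[X]; [Pdiv.Idomain.dvdp] over int only tests divisibility
   up to a nonzero integer factor. *)
Definition zpoly_dvd (f g : {poly int}) : Prop := exists h, g = h * f.

Definition graph_eigenvalue (R : realType) (G : sgraph) (a : R) : Prop :=
  eigenvalue (adjmx R G) a.

Section DivisibilityGraph.

Variable n : nat.

Definition divisor_adj : rel (seq_sub (divisors n)) :=
  fun a b => (a != b) && ((ssval a %| ssval b)%N || (ssval b %| ssval a)%N).

Lemma divisor_adj_sym : symmetric divisor_adj.
Proof. by move=> a b; rewrite /divisor_adj eq_sym orbC. Qed.

Lemma divisor_adj_irrefl : irreflexive divisor_adj.
Proof. by move=> a; rewrite /divisor_adj eqxx. Qed.

Definition divisor_graph : sgraph :=
  SGraph divisor_adj_sym divisor_adj_irrefl.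

End DivisibilityGraph.

Definition squarefree (n : nat) : bool :=
  all (fun p => logn p n == 1%N) (primes n).

Definition moebius (n : nat) : int :=
  if squarefree n then (-1) ^+ size (primes n) else 0.

Definition Omega (n : nat) : nat := (\sum_(p <- primes n) logn p n)%N.

(* Main.v *)
(* Nonplanarity: a drawing of K5 with disjoint independent edges is refuted by
   van Kampen's parity argument.  For disjoint edges ab and cd the map
   (x, y) |-> y - x from ab x cd to the plane does not vanish, so the number of
   times its boundary loop crosses a fixed ray is even.  This relates mod 2 the
   windings of cd around a and b, those of ab around c and d, and the positions
   of a, b relative to c, d.  Summed over the 15 pairs of disjoint edges, the
   windings cancel and the positions add up to an odd number.  Chains of five
   divisors give K5, and pqr gives a subdivided K5.

   Spectra: the adjacency matrix of the comparability graph of a product of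
   chains is Z + Z^T - 2, where Z is the Kronecker product of the zeta matrices
   of the factors.  For two chains of length 2 the antisymmetric vector
   e_p - e_q is fixed by both Z and Z^T, so tensoring with it embeds the
   spectrum of n into that of npq; with a third prime r the vectors e_p - e_q
   and e_q - e_r give two independent embeddings.  For n = p^a q^b the
   equation for the eigenvalue 0 is governed by a rotation of order 6. *)

Require Import Defs.
From mathcomp Require Import all_boot all_order all_algebra.
From mathcomp Require Import boolp classical_sets reals topology normedtype.
From mathcomp Require Import interval_inference.
From mathcomp Require Import ring lra zify.

Set Implicit Arguments.
Unset Strict Implicit.
Unset Printing Implicit Defensive.

Import Order.TTheory GRing.Theory Num.Theory.
Import numFieldNormedType.Exports.

Local Open Scope ring_scope.

(** * Crossing parities *)

(** [cr v i j] stands for the parity with which the edge [ij] crosses a fixed ray from [v], and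
    [up i j] for the side of [j] on which [i] lies. The sum is the crossing parity of the boundary
    of [ab x cd] under (x, y) |-> y - x. *)
Definition square_parity (V : Type) (cr : V -> V -> V -> bool)
    (up : V -> V -> bool) (a b c d : V) : bool :=
  (cr a c d (+) cr b c d) (+) (cr c a b (+) cr d a b) (+)
  ((up a c (+) up b c) (+) (up a d (+) up b d)).

(* Summed over the 15 pairs of disjoint edges of K5, every [cr v i j] occurs
   twice, while the [up] terms contribute an odd number of ones. *)
Lemma K5_parity (cr : nat -> nat -> nat -> bool) (up : nat -> nat -> bool) :
  (forall a b, (a < b < 5)%N -> up b a = ~~ up a b) ->
  (forall a b c d, uniq [:: a; b; c; d] ->
     (a < b < 5)%N -> (c < d < 5)%N -> (a < c)%N ->
     ~~ square_parity cr up a b c d) ->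
  False.
Proof.
move=> upN sq.
pose x a b c := nat_of_bool (cr a b c); pose u a b := nat_of_bool (up a b).
(* Booleans become numbers and evenness an explicit double, so that the count is linear integer
   arithmetic. *)
have {}sq a b c d : uniq [:: a; b; c; d] ->
    (a < b < 5)%N -> (c < d < 5)%N -> (a < c)%N -> exists k : nat,
  (x a c d + x b c d + (x c a b + x d a b) +
   (u a c + u b c + (u a d + u b d)) = k + k)%N.
  move=> h1 h2 h3 h4; have e := sq a b c d h1 h2 h3 h4.
  set s := (_ + _ + _)%N; exists s./2; rewrite addnn even_halfK //.
  by move: e; rewrite /square_parity /s /x /u !oddD !oddb.
have {}upN a b : (a < b < 5)%N -> (u b a + u a b = 1)%N.
  by rewrite /u => /upN ->; case: (up a b).
clearbody x u.
have [k0] := sq 0%N 1%N 2%N 3%N isT isT isT isT.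
have [k1] := sq 0%N 2%N 1%N 3%N isT isT isT isT.
have [k2] := sq 0%N 3%N 1%N 2%N isT isT isT isT.
have [k3] := sq 0%N 1%N 2%N 4%N isT isT isT isT.
have [k4] := sq 0%N 2%N 1%N 4%N isT isT isT isT.
have [k5] := sq 0%N 4%N 1%N 2%N isT isT isT isT.
have [k6] := sq 0%N 1%N 3%N 4%N isT isT isT isT.
have [k7] := sq 0%N 3%N 1%N 4%N isT isT isT isT.
have [k8] := sq 0%N 4%N 1%N 3%N isT isT isT isT.
have [k9] := sq 0%N 2%N 3%N 4%N isT isT isT isT.
have [k10] := sq 0%N 3%N 2%N 4%N isT isT isT isT.
have [k11] := sq 0%N 4%N 2%N 3%N isT isT isT isT.
have [k12] := sq 1%N 2%N 3%N 4%N isT isT isT isT.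
have [k13] := sq 1%N 3%N 2%N 4%N isT isT isT isT.
have [k14] := sq 1%N 4%N 2%N 3%N isT isT isT isT.
have := upN 1%N 2%N isT; have := upN 1%N 3%N isT; have := upN 1%N 4%N isT.
have := upN 2%N 3%N isT; have := upN 2%N 4%N isT; have := upN 3%N 4%N isT.
clear sq upN; lia.
Qed.

(** * Crossings of a ray by segments of the plane *)

Section Crossing.

Variable R : realFieldType.
Implicit Types u v z : R * R.

Definition dot u v : R := u.1 * v.1 + u.2 * v.2.

(* A half-plane with half of its boundary, so that it contains exactly one of [u]
   and [- u] when [u] is nonzero. *)
Definition upper u : bool := (0 < u.2) || ((u.2 == 0) && (0 < u.1)).

(* The segment from [u] to [v] crosses the negative half of the first axis. *)
Definition crossing u v : bool :=
  (upper u (+) upper v) && ((u.1 * v.2 - u.2 * v.1) * (v.2 - u.2) < 0).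

Lemma upperN u : u != 0 -> upper (- u) = ~~ upper u.
Proof.
case: u => a b; rewrite /upper /= -pair_eqE /= !oppr_gt0 oppr_eq0.
by case: (ltrgtP b 0) => //= _; case: (ltrgtP a 0).
Qed.

(** The segment meets the first axis at abscissa (u.1 v.2 - u.2 v.1) / (v.2 - u.2). That point has
    positive [dot] with [z], so its abscissa has the sign of [z.1]. *)
Lemma crossing_sign z u v : 0 < dot u z -> 0 < dot v z -> upper u (+) upper v ->
  0 < (u.1 * v.2 - u.2 * v.1) * (v.2 - u.2) * z.1.
Proof.
case: z u v => [z1 z2] [a b] [c d]; rewrite /dot /upper /= => uz vz.
have key : (a * d - b * c) * (d - b) * z1 =
   (a * z1 + b * z2) * (d * (d - b)) - (c * z1 + d * z2) * (b * (d - b)) by ring.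
have pos p q : 0 <= p -> 0 <= q -> 0 < p + q ->
    0 < (a * z1 + b * z2) * p - (c * z1 + d * z2) * - q.
  move=> p0 q0; rewrite mulrN opprK; move: p0; rewrite le_eqVlt => /predU1P[<-|p0].
    by rewrite add0r mulr0 add0r => /(mulr_gt0 vz).
  by move=> _; apply: ltr_pwDl; [apply: mulr_gt0|apply: mulr_ge0 => //; apply: ltW].
rewrite key -(opprK (b * (d - b))).
case: (ltrgtP b 0) => hb; case: (ltrgtP d 0) => hd //= hx; try by apply: pos; nra.
by exfalso; subst b d; move: hx; case: (ltrP 0 a); case: (ltrP 0 c) => //= *; nra.
Qed.

(* On an open half-plane [crossing] is a coboundary, hence it has no parity around
   a cell whose corners lie in such a half-plane. *)
Lemma crossing_potential z u v : 0 < dot u z -> 0 < dot v z ->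
  crossing u v = (z.1 < 0) && (upper u (+) upper v).
Proof.
move=> uz vz; rewrite /crossing andbC; case: (boolP (_ (+) _)); last by rewrite !andbF.
move=> /(crossing_sign uz vz); rewrite !andbT; set P := _ * (_ - _).
by case: (ltrgtP z.1 0) => hz; case: (ltrgtP P 0) => hP //; nra.
Qed.

(** A segment and its negative meet the first axis at opposite points, so if they meet it at all,
    exactly one of them does so on the negative half. *)
Lemma crossingN z u v : 0 < dot u z -> 0 < dot v z ->
  crossing (- u) (- v) = crossing u v (+) (upper u (+) upper v).
Proof.
move=> uz vz.
have nz w : 0 < dot w z -> w != 0.
  by apply: contraTneq => ->; rewrite /dot !mul0r addr0 ltxx.
have dN w : dot (- w) (- z) = dot w z by rewrite /dot /= !mulrNN.
rewrite (@crossing_potential (- z)) ?dN // (crossing_potential uz vz).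
rewrite !upperN ?nz // addbN addNb negbK.
case: (boolP (_ (+) _)) => [/(crossing_sign uz vz)|]; last by rewrite !andbF.
by rewrite oppr_lt0 /=; case: (ltrgtP z.1 0) => // ->; rewrite mulr0 ltxx.
Qed.

(** A discrete homotopy: the corners of each cell lie in an open half-plane, so its boundary crosses
    the ray an even number of times, and inner edges cancel in the sum over all cells. *)
Lemma crossing_grid (U : nat -> nat -> R * R) (z : nat -> nat -> R * R) (M N : nat) :
  (forall i j, (i < M)%N -> (j < N)%N ->
     [&& 0 < dot (U i j) (z i j), 0 < dot (U i j.+1) (z i j),
         0 < dot (U i.+1 j) (z i j) & 0 < dot (U i.+1 j.+1) (z i j)]) ->
  \big[addb/false]_(j < N) crossing (U 0 j)%N (U 0 j.+1)%N (+)
  \big[addb/false]_(j < N) crossing (U M j) (U M j.+1) =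
  \big[addb/false]_(i < M) crossing (U i 0)%N (U i.+1 0)%N (+)
  \big[addb/false]_(i < M) crossing (U i N) (U i.+1 N).
Proof.
elim: M => [|M IH] h; first by rewrite !big_ord0 addbb.
have {}IH := IH (fun i j hi => h i j (ltnW hi)).
rewrite !(big_ord_recr M) /= addbACA -IH.
set a := \big[_/_]_(j < N) crossing (U 0%N _) _.
set b := \big[_/_]_(j < N) crossing (U M _) _.
set c := \big[_/_]_(j < N) crossing (U M.+1 _) _.
(* Induction on [M] leaves only the last strip of cells; a second induction runs along it. *)
suff <- : b (+) c = crossing (U M 0)%N (U M.+1 0)%N (+) crossing (U M N) (U M.+1 N).
  by rewrite addbA -(addbA a) addbb addbF.
have {}h j : (j < N)%N -> _ := h M j (ltnSn M).
rewrite {}/b {}/c {a IH}; elim: N h => [|N IH] h; first by rewrite !big_ord0 !addbb.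
rewrite !big_ord_recr /= addbACA IH; last by move=> j hj; apply: h; apply: ltnW.
have /and4P[h1 h2 h3 h4] := h N (ltnSn N).
rewrite -addbA; congr (_ (+) _).
rewrite (crossing_potential h1 h3) (crossing_potential h1 h2).
rewrite (crossing_potential h3 h4) (crossing_potential h2 h4).
by case: (_.1 < 0) => //=; do 4 case: (upper _).
Qed.

Lemma addb_telescope (f : nat -> bool) N :
  \big[addb/false]_(i < N) (f i (+) f i.+1) = f 0%N (+) f N.
Proof.
elim: N => [|N IH]; first by rewrite big_ord0 addbb.
by rewrite big_ord_recr /= IH addbA -(addbA (f 0%N)) addbb addbF.
Qed.

(** Only the parity of the crossings of a polygonal path, in general not closed, with the ray from
    [p] in the negative direction of the first axis. *)
Definition winding (f : nat -> R * R) (p : R * R) (N : nat) : bool :=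
  \big[addb/false]_(k < N) crossing (f k - p) (f k.+1 - p).

(** [crossing_grid] applies to the differences [g j - f i]. Two sides of the grid are windings of
    [g]; the other two involve the negatives of the vectors [f i - g j], and [crossingN] turns them
    into windings of [f] at the cost of [upper] terms that telescope. *)
Lemma winding_square (f g : nat -> R * R) (N : nat) (z : nat -> nat -> R * R) :
  (forall i j, (i < N)%N -> (j < N)%N ->
     [&& 0 < dot (g j - f i) (z i j), 0 < dot (g j.+1 - f i) (z i j),
         0 < dot (g j - f i.+1) (z i j) & 0 < dot (g j.+1 - f i.+1) (z i j)]) ->
  (0 < N)%N ->
  (winding g (f 0%N) N (+) winding g (f N) N) (+)
  (winding f (g 0%N) N (+) winding f (g N) N) (+)
  ((upper (f 0%N - g 0%N) (+) upper (f N - g 0%N)) (+)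
   (upper (f 0%N - g N) (+) upper (f N - g N))) = false.
Proof.
move=> h N0; rewrite /winding (crossing_grid (U := fun i j => g j - f i) h).
have side j : (forall i, (i < N)%N -> exists w,
      (0 < dot (g j - f i) w) && (0 < dot (g j - f i.+1) w)) ->
    \big[addb/false]_(i < N) crossing (g j - f i) (g j - f i.+1) =
    \big[addb/false]_(i < N) crossing (f i - g j) (f i.+1 - g j) (+)
    (upper (f 0%N - g j) (+) upper (f N - g j)).
  move=> hw; rewrite -(addb_telescope (fun i => upper (f i - g j))) -big_split /=.
  apply: eq_bigr => i _; have [w /andP[w1 w2]] := hw i (ltn_ord i).
  rewrite -(opprB (f i)) -(opprB (f i.+1)) (@crossingN (- w)) //.
    by move: w1; rewrite -(opprB (f i)) /dot /= !mulrN !mulNr.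
  by move: w2; rewrite -(opprB (f i.+1)) /dot /= !mulrN !mulNr.
rewrite (side 0%N); last first.
  by move=> i hi; exists (z i 0)%N; have /and4P[-> _ ->] := h i 0%N hi N0.
rewrite (side N); last first.
  move=> i hi; exists (z i N.-1)%N; have := h i N.-1 hi.
  by rewrite prednK // => /(_ (leqnn _)) /and4P[_ -> _ ->].
by do 2 case: (bigop _ _ _) => //=; do 4 case: (upper _).
Qed.

End Crossing.

Lemma dot_gt0_near (R : realFieldType) (u : R * R) : u != 0 ->
  exists2 e : R, 0 < e & forall v w : R * R,
    `|v.1 - u.1| < e -> `|v.2 - u.2| < e ->
    `|w.1 - u.1| < e -> `|w.2 - u.2| < e -> 0 < dot v w.
Proof.
case: u => a b u0; pose m := Num.max `|a| `|b|.
have am : `|a| <= m by rewrite le_max lexx.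
have bm : `|b| <= m by rewrite le_max lexx orbT.
have m0 : 0 < m.
  by rewrite lt_max !normr_gt0 -negb_and; move: u0; rewrite -pair_eqE.
have mm : m ^+ 2 <= a ^+ 2 + b ^+ 2.
  rewrite /m -(real_normK (num_real a)) -(real_normK (num_real b)) /Num.max.
  by case: ifP => _; rewrite ?lerDr ?lerDl exprn_ge0.
(* As [m] is the sup norm, the square of the length of [u] is at least m^2, while the six error
   terms add up to at most 4 m^2 / 8 + 2 m^2 / 64. *)
exists (m / 8) => [|[v1 v2] [w1 w2] /=]; first by lra.
move: am bm; rewrite !ler_norml !ltr_norml => /andP[? ?] /andP[? ?].
move=> /andP[? ?] /andP[? ?] /andP[? ?] /andP[? ?]; rewrite /dot /=.
have sm (x y e f : R) : - e <= x <= e -> - f <= y <= f -> - (e * f) <= x * y.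
  by move=> /andP[? ?] /andP[? ?]; nra.
have h1 : - (m * (m / 8)) <= a * (w1 - a) by apply: sm; apply/andP; split; lra.
have h2 : - (m * (m / 8)) <= b * (w2 - b) by apply: sm; apply/andP; split; lra.
have h3 : - (m * (m / 8)) <= a * (v1 - a) by apply: sm; apply/andP; split; lra.
have h4 : - (m * (m / 8)) <= b * (v2 - b) by apply: sm; apply/andP; split; lra.
have h5 : - (m / 8 * (m / 8)) <= (v1 - a) * (w1 - a) by apply: sm; apply/andP; split; lra.
have h6 : - (m / 8 * (m / 8)) <= (v2 - b) * (w2 - b) by apply: sm; apply/andP; split; lra.
nra.
Qed.

(** * A uniform mesh for two disjoint arcs *)

Section Mesh.

Variable R : realType.
Local Open Scope classical_set_scope.
Local Open Scope ring_scope.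

Lemma within_itv_dist (f : R -> R * R) (s0 e : R) :
  {within `[0, 1], continuous f} -> s0 \in `[0, 1] -> 0 < e ->
  exists2 d : R, 0 < d & forall s, s \in `[0, 1] -> `|s - s0| < d ->
    `|(f s).1 - (f s0).1| < e /\ `|(f s).2 - (f s0).2| < e.
Proof.
move=> /subspace_continuousP cf s01 e0.
have /cvg_ball /(_ e e0) := cf s0 s01.
rewrite near_withinE => /nbhs_ballP[d d0 hd]; exists d => // s s1 sd.
have /(_ _ s1)[] := hd s; first by rewrite /ball /= distrC.
by rewrite /ball /= [`|_ - (f s).1|]distrC [`|_ - (f s).2|]distrC.
Qed.

(** Near each pair of parameters the difference stays within the tolerance of [dot_gt0_near];
    compactness of the unit square makes one mesh size fit everywhere. *)
Lemma separated_mesh (f g : R -> R * R) :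
  {within `[0, 1], continuous f} -> {within `[0, 1], continuous g} ->
  {in `[0, 1] &, forall s t, f s != g t} ->
  \forall N \near \oo, {in `[0, 1] &, forall s t, {in `[0, 1] &, forall s' t',
    `|s' - s| <= N.+1%:R^-1 -> `|t' - t| <= N.+1%:R^-1 ->
    0 < dot (g t' - f s') (g t - f s)}}.
Proof.
move=> cf cg fg.
have /compact_near_coveringP cpt :=
  compact_setX (@segment_compact R 0 1) (@segment_compact R 0 1).
pose P (N : nat) (x : R * R) := x.1 \in `[0, 1] -> x.2 \in `[0, 1] ->
  {in `[0, 1] &, forall s' t',
    `|s' - x.1| <= N.+1%:R^-1 -> `|t' - x.2| <= N.+1%:R^-1 ->
    0 < dot (g t' - f s') (g x.2 - f x.1)}.
have locP : forall x : R * R, (`[0, 1] `*` `[0, 1])%classic x ->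
    \forall x' \near x & N \near \oo, P N x'.
  move=> [s0 t0] /= [s01 t01].
  have ne : g t0 - f s0 != 0 by rewrite subr_eq0 eq_sym; apply: fg.
  have [e e0 he] := dot_gt0_near ne.
  (* Half the tolerance for each of [f] and [g], whose errors add up in the difference. *)
  have e20 : 0 < e / 2 by rewrite divr_gt0.
  have [d d0 hd] := within_itv_dist cf s01 e20.
  have [d' d0' hd'] := within_itv_dist cg t01 e20.
  (* One [c] covers the distance from [(s0, t0)] to [(s, t)], another the mesh step to
     [(s', t')]. *)
  pose c := Num.min d d' / 2.
  have c0 : 0 < c by rewrite divr_gt0 // lt_min d0.
  have cd : c + c <= d by rewrite -splitr ge_min lexx.
  have cd' : c + c <= d' by rewrite -splitr ge_min lexx orbT.
  exists (ball (s0, t0) c, [set N | N.+1%:R^-1 < c]).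
    split; first exact: nbhsx_ballx.
    exact: near_infty_natSinv_lt (PosNum c0).
  move=> [[s t] N] /= [[ss0 tt0] Nc] s1 t1 s' t' s'1 t'1 s's t't.
  rewrite /ball /= in ss0 tt0 *.
  have near2 : forall (h : R -> R * R) x0 x x' dd,
      (forall s, s \in `[0, 1] -> `|s - x0| < dd ->
        `|(h s).1 - (h x0).1| < e / 2 /\ `|(h s).2 - (h x0).2| < e / 2) ->
      c + c <= dd -> x \in `[0, 1] -> x' \in `[0, 1] ->
      `|x0 - x| < c -> `|x' - x| <= N.+1%:R^-1 ->
     [/\ `|(h x).1 - (h x0).1| < e / 2, `|(h x).2 - (h x0).2| < e / 2,
       `|(h x').1 - (h x0).1| < e / 2 & `|(h x').2 - (h x0).2| < e / 2].
    move=> h x0 x x' dd hh cdd x1 x'1 xx0 x'x.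
    have [] : `|x - x0| < dd /\ `|x' - x0| < dd.
      split; first by rewrite distrC; apply: lt_le_trans cdd; rewrite ltr_wpDl // ltW.
      rewrite -(subrKA x); apply: le_lt_trans (ler_normD _ _) _.
      apply: lt_le_trans cdd; apply: ltrD.
        exact: le_lt_trans Nc.
      by rewrite distrC.
    by move=> /(hh x x1)[? ?] /(hh x' x'1)[].
  have [a1 a2 a3 a4] := near2 f s0 s s' d hd cd s1 s'1 ss0 s's.
  have [b1 b2 b3 b4] := near2 g t0 t t' d' hd' cd' t1 t'1 tt0 t't.
  have half (x y x' y' : R) : `|x - y| < e / 2 -> `|x' - y'| < e / 2 ->
      `|x - x' - (y - y')| < e.
    have -> : x - x' - (y - y') = x - y - (x' - y') by ring.
    move=> xy xy'; rewrite (splitr e).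
    exact: le_lt_trans (ler_normB _ _) (ltrD xy xy').
  by apply: he; apply: half.
apply: (@filterS _ \oo _ _ _ _ (cpt nat \oo P _ locP)) => N hN s t s1 t1.
by apply: (hN (s, t)) => //; split.
Qed.

End Mesh.

(** Two squares are glued along a side, whose terms [d] and [q] cancel. *)
Lemma addb_glue (a a' b b' c d e p q r : bool) :
  a (+) a' (+) (c (+) d) (+) (p (+) q) = false ->
  b (+) b' (+) (d (+) e) (+) (q (+) r) = false ->
  (a (+) b) (+) (a' (+) b') (+) (c (+) e) (+) (p (+) r) = false.
Proof.
move=> ep eq; rewrite (addbACA a b).
have -> : c (+) e = c (+) d (+) (d (+) e) by rewrite addbA addbK.
have -> : p (+) r = p (+) q (+) (q (+) r) by rewrite addbA addbK.
by rewrite [X in X (+) _]addbACA addbACA ep eq.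
Qed.

(** * The parity obstruction in a planar drawing *)

Section Nonplanarity.

Local Open Scope classical_set_scope.
Local Open Scope ring_scope.

Variables (R : realType) (G : sgraph).
Variables (pt : G -> R * R) (arc : G -> G -> R -> R * R).
Hypothesis drw : planar_drawing pt arc.

(** A drawing separates the open arcs directly; the endpoints follow from injectivity of [pt] and
    from arcs avoiding points. *)
Lemma disjoint_arcs a b c d : adj a b -> adj c d -> uniq [:: a; b; c; d] ->
  {in `[0, 1] &, forall s t, arc a b s != arc c d t}.
Proof.
move=> ab cd; rewrite /= !inE !negb_or andbT => /and3P[/and3P[_ ac ad] /andP[bc bd] _].
have itv (s : R) : s \in `[0, 1] -> [\/ s = 0, s = 1 | s \in `]0, 1[].
  rewrite !in_itv /= => /andP[]; rewrite le_eqVlt => /predU1P[->|s0]; first by constructor 1.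
  by rewrite le_eqVlt => /predU1P[->|s1]; [constructor 2|constructor 3; rewrite s0].
have ptN x y : x != y -> pt x != pt y by apply: contraNneq => /(pt_inj drw) ->.
move=> s t /itv[->|->|s01] /itv[->|->|t01];
  rewrite ?(arc_start drw) ?(arc_end drw) ?ptN //.
- by rewrite eq_sym (arc_avoids_pt drw).
- by rewrite eq_sym (arc_avoids_pt drw).
- by rewrite (arc_avoids_pt drw).
- by rewrite (arc_avoids_pt drw).
apply: (arc_disjoint drw) => //; apply: contraNneq ac => /setP/(_ a).
by rewrite !inE eqxx /= (negPf ad) orbF => <-.
Qed.

Definition pt_above (x y : G) : bool := upper (pt x - pt y).

Definition arc_winding (N : nat) (v a b : G) : bool :=
  winding (fun k => arc a b (k%:R / N%:R)) (pt v) N.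

Lemma pt_aboveN x y : x != y -> pt_above y x = ~~ pt_above x y.
Proof.
by move=> xy; rewrite /pt_above -opprB upperN // subr_eq0 (inj_eq (pt_inj drw)).
Qed.

(** The winding parities depend on a mesh, hence the existential: the finitely many pairs of edges
    admit a mesh fine enough for all of them. *)
Lemma edge_square_parity : exists cr : G -> G -> G -> bool,
  forall a b c d, adj a b -> adj c d -> uniq [:: a; b; c; d] ->
  ~~ square_parity cr pt_above a b c d.
Proof.
pose good (x : G * G * (G * G)) (N : nat) :=
  adj x.1.1 x.1.2 -> adj x.2.1 x.2.2 -> uniq [:: x.1.1; x.1.2; x.2.1; x.2.2] ->
  ~~ square_parity (arc_winding N.+1) pt_above x.1.1 x.1.2 x.2.1 x.2.2.
suff [N _ goodN] : \forall N \near \oo, forall x, good x N.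
  exists (arc_winding N.+1) => a b c d.
  exact: (goodN N (leqnn N) ((a, b), (c, d))).
apply: (@filter_forall _ _ good) => -[[a b] [c d]]; rewrite /good /=.
have [/and3P[ab cd u]|bad] :=
    boolP [&& adj a b, adj c d & uniq [:: a; b; c; d]]; last first.
  apply: (@filterE _ \oo) => N ab cd u.
  by move: bad; rewrite ab cd [uniq _]u.
apply: (@filterS _ \oo _ _ _ _ (separated_mesh (arc_continuous drw ab)
  (arc_continuous drw cd) (disjoint_arcs ab cd u))) => N mesh _ _ _.
pose f i := arc a b (i%:R / N.+1%:R); pose g i := arc c d (i%:R / N.+1%:R).
have in01 k : (k <= N.+1)%N -> k%:R / N.+1%:R \in `[0 : R, 1].
  move=> kN; rewrite in_itv /= divr_ge0 //= ler_pdivrMr ?ltr0n //.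
  by rewrite mul1r ler_nat.
have close k : `|k.+1%:R / N.+1%:R - k%:R / N.+1%:R| <= N.+1%:R^-1 :> R.
  by rewrite -mulrBl -natrB // subSnn mul1r ger0_norm.
have close0 k : `|k%:R / N.+1%:R - k%:R / N.+1%:R| <= N.+1%:R^-1 :> R.
  by rewrite subrr normr0.
have := @winding_square R f g N.+1 (fun i j => g j - f i).
have f0 : f 0%N = pt a by rewrite /f mul0r (arc_start drw).
have g0 : g 0%N = pt c by rewrite /g mul0r (arc_start drw).
have fN : f N.+1 = pt b by rewrite /f divff ?pnatr_eq0 // (arc_end drw).
have gN : g N.+1 = pt d by rewrite /g divff ?pnatr_eq0 // (arc_end drw).
rewrite f0 g0 fN gN => sq; apply/negbT/sq => // i j iN jN.
by apply/and4P; split; apply: mesh; rewrite ?in01 // ltnW.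
Qed.

Fixpoint walk_winding (cr : G -> G -> G -> bool) (v x : G) (s : seq G) : bool :=
  if s is y :: s' then cr v x y (+) walk_winding cr v y s' else false.

(** Parities add up under gluing, so a subdivided edge behaves like an edge. Gluing runs first along
    the walk from [c], against a single edge, then along the walk from [a]. *)
Lemma walk_square_parity (cr : G -> G -> G -> bool) a s c t :
  (forall a b c d, adj a b -> adj c d -> uniq [:: a; b; c; d] ->
     ~~ square_parity cr pt_above a b c d) ->
  path (@adj G) a s -> path (@adj G) c t -> ~~ has (mem (a :: s)) (c :: t) ->
  walk_winding cr a c t (+) walk_winding cr (last a s) c t (+)
  (walk_winding cr c a s (+) walk_winding cr (last c t) a s) (+)
  ((pt_above a c (+) pt_above (last a s) c) (+)
   (pt_above a (last c t) (+) pt_above (last a s) (last c t))) = false.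
Proof.
move=> sq; have nadj (x y : G) : adj x y -> x != y.
  by apply: contraTneq => ->; rewrite adj_irrefl.
have edge x y z u : adj x y -> path (@adj G) z u -> ~~ has (mem [:: x; y]) (z :: u) ->
    walk_winding cr x z u (+) walk_winding cr y z u (+)
    (cr z x y (+) cr (last z u) x y) (+)
    ((pt_above x z (+) pt_above y z) (+)
     (pt_above x (last z u) (+) pt_above y (last z u))) = false.
  move=> xy; elim: u z => [|w u IH] z; first by move=> _ _; rewrite /= !addbb.
  move=> /= /andP[zw pw] /norP[zxy /norP[wxy h]].
  have := sq x y z w xy zw; rewrite /square_parity /= !inE !negb_or (nadj _ _ xy).
  move: zxy wxy; rewrite /= !inE !negb_or ![_ == x]eq_sym ![_ == y]eq_sym.
  move=> /andP[-> ->] /andP[wx wy]; rewrite wx wy (nadj _ _ zw) => /(_ isT).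
  have := IH w pw; rewrite /= !inE !negb_or ![w == _]eq_sym wx wy h => /(_ isT).
  by move=> e1 e2; apply: addb_glue (negbTE e2) e1.
elim: s a => [|a' s IH] a; first by move=> _ _ _; rewrite /= !addbb.
move=> /andP[aa' pa'] pc h.
have sub (s1 : seq G) : {subset s1 <= [:: a, a' & s]} -> ~~ has (mem s1) (c :: t).
  by move=> sub; apply/hasPn => x /(hasPn h); apply: contra => /sub.
rewrite [X in X (+) _]addbC [X in _ (+) X]addbACA /=.
apply: (addb_glue (d := walk_winding cr a' c t)
  (q := pt_above a' c (+) pt_above a' (last c t))).
  rewrite [X in X (+) _]addbC [X in _ (+) X]addbACA.
  apply: edge => //; apply: sub => x.
  by rewrite !inE => /orP[->|->]; rewrite ?orbT.
rewrite [X in X (+) _]addbC [X in _ (+) X]addbACA.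
apply: IH => //; apply: sub => x.
by rewrite [in X in _ -> X]inE => ->; rewrite orbT.
Qed.

(* The walk [v i :: s i j] is the edge of K5 between [i] and [j]. *)
Lemma no_subdivided_K5 (v : nat -> G) (s : nat -> nat -> seq G) :
  (forall i j, (i < j < 5)%N -> v i != v j) ->
  (forall i j, (i < j < 5)%N -> path (@adj G) (v i) (s i j)) ->
  (forall i j, (i < j < 5)%N -> last (v i) (s i j) = v j) ->
  (forall i j k l, uniq [:: i; j; k; l] -> (i < j < 5)%N -> (k < l < 5)%N ->
     (i < k)%N -> ~~ has (mem (v i :: s i j)) (v k :: s k l)) ->
  False.
Proof.
move=> vN ps ls dis; have [cr sq] := edge_square_parity.
apply: (@K5_parity (fun x i j => walk_winding cr (v x) (v i) (s i j))
                   (fun i j => pt_above (v i) (v j))) => [i j ij|i j k l u ij kl ik].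
  by rewrite pt_aboveN ?vN.
have := walk_square_parity sq (ps i j ij) (ps k l kl) (dis i j k l u ij kl ik).
by rewrite !ls // /square_parity => ->.
Qed.

End Nonplanarity.

(** * Divisor lattices as products of chains *)

Section DivisorPosets.

Local Open Scope nat_scope.

Section ComparabilityGraph.

Variables (T : finType) (le : rel T).

Definition comparable_adj : rel T := fun x y => (x != y) && (le x y || le y x).

Lemma comparable_adj_sym : symmetric comparable_adj.
Proof. by move=> x y; rewrite /comparable_adj eq_sym orbC. Qed.

Lemma comparable_adj_irrefl : irreflexive comparable_adj.
Proof. by move=> x; rewrite /comparable_adj eqxx. Qed.

Definition comparability_graph : sgraph :=
  SGraph comparable_adj_sym comparable_adj_irrefl.

End ComparabilityGraph.

Definition graph_iso (G H : sgraph) (g : G -> H) : Prop :=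
  bijective g /\ forall x y, adj (g x) (g y) = adj x y.

(** A model of the divisor lattice: with tuples of exponents in place of numbers, adjacency can be
    settled by case analysis. *)
Definition divisor_poset (n : nat) (T : finType) (le : rel T) : Prop :=
  exists f : T -> nat, [/\ injective f, forall x y, (f x %| f y) = le x y &
    forall d, (d %| n) <-> exists x, f x = d].

(** The chain [C] enters through a rank function, so that one construction covers [bool] for a
    simple prime factor and ['I_a.+1] for a prime power. *)
Definition prod_le (T C : finType) (le : rel T) (r : C -> nat) : rel (T * C) :=
  fun x y => le x.1 y.1 && (r x.2 <= r y.2).

Lemma dvdn_mul_pexp p m n i j : prime p -> ~~ (p %| m) -> ~~ (p %| n) ->
  (m * p ^ i %| n * p ^ j) = (m %| n) && (i <= j).
Proof.
move=> pp pm pn.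
have cop k h : ~~ (p %| k) -> coprime k (p ^ h).
  by move=> pk; rewrite coprime_sym coprimeXl // prime_coprime.
rewrite Gauss_dvd ?cop // Gauss_dvdl ?cop // Gauss_dvdr ?dvdn_Pexp2l ?prime_gt1 //.
by rewrite coprime_sym cop.
Qed.

Lemma divisor_poset1 : divisor_poset 1 (fun _ _ : unit => true).
Proof.
exists (fun=> 1); split=> [[] [] //|//|d].
by rewrite dvdn1; split=> [/eqP->|[_ <-]//]; exists tt.
Qed.

Lemma divisor_poset_mul n (T : finType) (le : rel T) p a (C : finType) (r : C -> nat) :
  n > 0 -> divisor_poset n le -> prime p -> ~~ (p %| n) ->
  injective r -> (forall k, (k <= a) <-> exists c, r c = k) ->
  divisor_poset (n * p ^ a) (prod_le le r).
Proof.
move=> n0 [f [injf fle fim]] pp pn injr rim.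
have fn x : f x %| n by apply/fim; exists x.
have pf x : ~~ (p %| f x) by apply: contra pn => /dvdn_trans; apply.
exists (fun x => f x.1 * p ^ r x.2); split.
- move=> [x c] [y d] /= e; have /eqP := e; rewrite eqn_dvd !dvdn_mul_pexp //.
  case/andP=> /andP[xy cd] /andP[yx dc]; congr pair.
    by apply: injf; apply/eqP; rewrite eqn_dvd xy.
  by apply: injr; apply/eqP; rewrite eqn_leq cd.
- by move=> x y; rewrite dvdn_mul_pexp // fle.
move=> d; split=> [dn|[[x c] <-]] /=; last first.
  by rewrite dvdn_mul_pexp // fn; apply/rim; exists c.
have d0 : d > 0 by apply: dvdn_gt0 dn; rewrite muln_gt0 n0 expn_gt0 prime_gt0.
have [m pm dE] := pfactor_coprime pp d0; rewrite dE.
have pm' : ~~ (p %| m) by rewrite -prime_coprime.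
move: dn; rewrite dE dvdn_mul_pexp // -dE => /andP[/fim[x <-] /rim[c <-]].
by exists (x, c).
Qed.

Lemma divisor_poset_mul_prime n (T : finType) (le : rel T) p :
  n > 0 -> divisor_poset n le -> prime p -> ~~ (p %| n) ->
  divisor_poset (n * p) (prod_le le nat_of_bool).
Proof.
move=> n0 dn pp pn; rewrite -(expn1 p).
apply: (divisor_poset_mul n0 dn pp pn) => [[] []|k] //.
split=> [|[[] <-] //]; case: k => [|[|]] // _; first by exists false.
by exists true.
Qed.

Lemma divisor_poset_mul_pexp n (T : finType) (le : rel T) p a :
  n > 0 -> divisor_poset n le -> prime p -> ~~ (p %| n) ->
  divisor_poset (n * p ^ a) (prod_le le (@nat_of_ord a.+1)).
Proof.
move=> n0 dn pp pn.
apply: (divisor_poset_mul n0 dn pp pn) => [|k]; first exact: val_inj.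
by split=> [ka|[c <-]]; [exists (Ordinal (ka : k < a.+1))|rewrite -ltnS].
Qed.

Lemma divisor_poset_iso n (T : finType) (le : rel T) : n > 0 -> divisor_poset n le ->
  exists g : comparability_graph le -> divisor_graph n, graph_iso g.
Proof.
move=> n0 [f [injf fle fim]].
have fn x : f x \in divisors n by rewrite -dvdn_divisors //; apply/fim; exists x.
pose g x : seq_sub (divisors n) := SeqSub (fn x).
exists g; split; last first.
  move=> x y; rewrite /= /divisor_adj /comparable_adj /= !fle.
  by rewrite -[g x == _]val_eqE /= (inj_eq injf).
have ex (d : seq_sub (divisors n)) : exists x, f x == ssval d.
  have /fim[x <-] : ssval d %| n by rewrite dvdn_divisors //; exact: ssvalP.
  by exists x.
exists (fun d => xchoose (ex d)) => [x|d]; last exact/val_inj/eqP/(xchooseP (ex d)).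
exact/injf/eqP/(xchooseP (ex (g x))).
Qed.

Lemma divisor_posetP n : n > 0 ->
  divisor_poset n (fun x y : seq_sub (divisors n) => ssval x %| ssval y).
Proof.
move=> n0; exists (@ssval _ _); split=> //; first exact: val_inj.
move=> d; rewrite dvdn_divisors //; split=> [dn|[x <-]]; last exact: ssvalP.
by exists (SeqSub dn).
Qed.

End DivisorPosets.

(** * Planar divisor graphs *)

(** A certificate to be checked by computation: [v] gives the branch vertices as numbers below [m],
    and [s i j] the walk from [v i] to [v j] without its first vertex. *)
Definition subdivided_K5 (m : nat) (e : rel nat) (v : nat -> nat)
    (s : nat -> nat -> seq nat) : bool :=
  all (fun i => all (fun j => (i < j)%N ==>
    [&& v i != v j, (v j < m)%N, all (gtn m) (v i :: s i j), path e (v i) (s i j),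
        last (v i) (s i j) == v j &
      all (fun k => all (fun l =>
        [&& k < l, i < k & uniq [:: i; j; k; l]]%N ==>
        ~~ has (mem (v i :: s i j)) (v k :: s k l)) (iota 0 5)) (iota 0 5)])
    (iota 0 5)) (iota 0 5).

Lemma subdivided_K5_nonplanar (R : realType) (G : sgraph) (m : nat)
    (e : rel nat) v s (f : nat -> G) :
  {in gtn m &, injective f} -> {in gtn m &, forall x y, e x y -> adj (f x) (f y)} ->
  subdivided_K5 m e v s -> ~ planar R G.
Proof.
move=> injf fe /allP K5 [pt [arc drw]].
have in5 i : (i < 5)%N -> i \in iota 0 5 by rewrite mem_iota.
have {}K5 i j : (i < j < 5)%N ->
  [/\ v i != v j /\ (v j < m)%N, all (gtn m) (v i :: s i j), path e (v i) (s i j),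
    last (v i) (s i j) = v j &
    forall k l, (k < l < 5)%N -> (i < k)%N -> uniq [:: i; j; k; l] ->
    ~~ has (mem (v i :: s i j)) (v k :: s k l)].
  case/andP=> ij j5; have /allP/(_ j (in5 j j5)) := K5 i (in5 i (ltn_trans ij j5)).
  rewrite ij => /and5P[-> -> -> -> /andP[/eqP-> /allP dis]]; split=> // k l.
  case/andP=> kl l5 ik u.
  have /allP/(_ l (in5 l l5)) := dis k (in5 k (ltn_trans kl l5)).
  by rewrite kl ik u.
apply: (@no_subdivided_K5 R G pt arc drw (f \o v) (fun i j => map f (s i j))).
- move=> i j /K5[[vij vj] /andP[vi _] _ _ _].
  by apply: contraNneq vij => /injf->.
- move=> i j /K5[_ ms p _ _]; rewrite /= path_map.
  by apply: (sub_in_path (P := gtn m)) p => // a b; apply: fe.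
- by move=> i j /K5[_ _ _ lst _]; rewrite /= last_map lst.
move=> i j k l u /K5[_ ms _ _ dis] kl ik.
have /hasPn h := dis k l kl ik u; have [_ /allP ms' _ _ _] := K5 k l kl.
apply/hasPn => x.
change (x \in map f (v k :: s k l) -> x \notin map f (v i :: s i j)) => /mapP[y yk ->].
apply: contra (h y yk) => /mapP[z zi].
by move/injf => -> //; [exact: ms'|exact: (allP ms)].
Qed.

Section DivisorGraphs.

Variables (R : realType) (n : nat).
Hypothesis n_gt0 : (0 < n)%N.

Lemma divisor_graph_chain5_nonplanar (c : nat -> nat) :
  (forall i, (i < 4)%N -> (c i < c i.+1)%N && (c i %| c i.+1)%N) ->
  (c 4 %| n)%N -> ~ planar R (divisor_graph n).
Proof.
move=> cS c4.
have mono i j : (i <= j < 5)%N -> (c i <= c j)%N /\ (c i %| c j)%N.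
  elim: j => [|j IH]; first by rewrite leqn0 andbT => /eqP->.
  case/andP; rewrite leq_eqVlt => /predU1P[-> _|ij j5]; first by split.
  have [le dv] := IH (introT andP (conj ij (ltnW j5))).
  have /andP[lt dv'] := cS j j5.
  by split; [apply: leq_trans le (ltnW lt)|apply: dvdn_trans dv'].
have lt i j : (i < j < 5)%N -> (c i < c j)%N.
  case/andP=> ij j5; have /andP[ci _] := cS i (leq_trans ij j5).
  by apply: leq_trans ci _; have [] := mono i.+1 j (introT andP (conj ij j5)).
(* [minn i 4] continues the chain as a constant beyond index 4, so that [f] below is defined on all
   of [nat]. *)
have cn i : c (minn i 4) \in divisors n.
  rewrite -dvdn_divisors //; apply: dvdn_trans c4.
  by have [] := mono (minn i 4) 4%N; rewrite ?geq_minr.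
have cneq : {in gtn 5 &, injective (fun i => c (minn i 4))}.
  move=> i j; rewrite !inE => i5 j5; rewrite !(minn_idPl _) // => cij.
  case: (ltngtP i j) => // ij.
    by have := lt i j; rewrite ij j5 cij ltnn => /(_ isT).
  by have := lt j i; rewrite ij i5 cij ltnn => /(_ isT).
pose f i : divisor_graph n := SeqSub (cn i).
apply: (@subdivided_K5_nonplanar R _ 5%N (fun i j => i != j) id (fun _ j => [:: j]) f).
- by move=> i j i5 j5 /(congr1 (@ssval _ _)) /cneq; apply.
- move=> i j i5 j5 ij; rewrite /= /divisor_adj -val_eqE /=.
  rewrite (inj_in_eq cneq) // ij /=; move: i5 j5; rewrite !inE => i5 j5.
  rewrite !(minn_idPl _) //; apply/orP.
  case/orP: (leq_total i j) => le; [left|right].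
    by have [] := mono i j; rewrite ?le.
  by have [] := mono j i; rewrite ?le.
by vm_compute.
Qed.

End DivisorGraphs.

Lemma divisor_graph_pqr_nonplanar (R : realType) (p q r : nat) :
  prime p -> prime q -> prime r -> p != q -> p != r -> q != r ->
  ~ planar R (divisor_graph (p * q * r)).
Proof.
move=> pp pq pr npq npr nqr.
have p0 := prime_gt0 pp; have q0 := prime_gt0 pq.
have p1 : ~~ (p %| 1)%N by rewrite dvdn1 gtn_eqF ?prime_gt1.
have qp : ~~ (q %| p)%N by rewrite dvdn_prime2 // eq_sym.
have rpq : ~~ (r %| p * q)%N.
  by rewrite Euclid_dvdM // !dvdn_prime2 // negb_or ![r == _]eq_sym npr.
have := divisor_poset_mul_prime (ltn0Sn 0) divisor_poset1 pp p1.
rewrite mul1n => /(divisor_poset_mul_prime p0)/(_ pq qp).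
have pq0 : (0 < p * q)%N by rewrite muln_gt0 p0.
move=> /(divisor_poset_mul_prime pq0)/(_ pr rpq).
have pqr0 : (0 < p * q * r)%N by rewrite muln_gt0 pq0 prime_gt0.
move=> /(divisor_poset_iso pqr0)[g [bijg gadj]].
(* The bits of [k] are the exponents of [p], [q], [r]; the branch vertices 0, 7, 1, 2, 4 are thus 1,
   pqr, p, q, r. *)
pose bits k := (tt, odd k, odd k./2, odd k./2./2).
pose le := prod_le (prod_le (prod_le (fun _ _ : unit => true) nat_of_bool)
  nat_of_bool) nat_of_bool.
(* The primes [p], [q], [r] are joined to one another through [p * q], [p * r]
   and [q * r]. *)
pose s (i j : nat) := match i, j with
  | 2, 3 => [:: 3; 2] | 2, 4 => [:: 5; 4] | 3, 4 => [:: 6; 4]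
  | _, _ => [:: nth 0 [:: 0; 7; 1; 2; 4] j]
  end%N.
apply: (@subdivided_K5_nonplanar R _ 8 (fun x y => comparable_adj le (bits x) (bits y))
  (nth 0 [:: 0; 7; 1; 2; 4])%N s (fun k => g (bits k))).
- move=> x y x8 y8 /(bij_inj bijg).
  by do 8 (case: x x8 => [|x] x8; first by do 8 (case: y y8 => [|y] y8 //)).
- by move=> x y _ _; rewrite gadj.
by vm_compute.
Qed.

(** Prime factors are split off one at a time. Four of them, with multiplicity, give the chain 1, p,
    pq, pqr, n; exactly three distinct ones give a subdivided K5; all other cases are in the
    list. *)
Lemma planar_divisor_graph_form (R : realType) (n : nat) : (0 < n)%N ->
  planar R (divisor_graph n) ->
  exists p q : nat, [/\ prime p, prime q, p <> q &
    n \in [:: 1; p; p ^ 2; p ^ 3; p * q; p ^ 2 * q]%N].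
Proof.
have prime_factor m : (0 < m)%N ->
    m = 1%N \/ exists2 p, prime p & exists2 k, (0 < k)%N & m = (p * k)%N.
  move=> m0; have [m1|m1] := leqP m 1; [left; lia|right].
  exists (pdiv m); first exact: pdiv_prime.
  exists (m %/ pdiv m)%N; last by rewrite mulnC divnK ?pdiv_dvd.
  by rewrite divn_gt0 ?pdiv_gt0 // dvdn_leq ?pdiv_dvd.
(* The conclusion asks for a second prime even when [n] is a prime power. *)
have other p : prime p -> exists2 q, prime q & p <> q.
  move=> pp; exists (if p == 2 then 3 else 2)%N; first by case: ifP.
  by case: eqP => // ->.
move=> n0 pl; have [n1|[p pp [k k0 nE]]] := prime_factor n n0.
  by exists 2%N, 3%N; rewrite n1.
have [q' pq' npq'] := other p pp.
have [k1|[q pq [l l0 kE]]] := prime_factor k k0.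
  by exists p, q'; rewrite nE k1 muln1 !inE eqxx orbT.
have [l1|[r pr [m m0 lE]]] := prime_factor l l0.
  have [pqE|npq] := eqVneq p q.
    by exists p, q'; rewrite nE kE l1 muln1 -pqE !inE eqxx !orbT.
  exists p, q; rewrite nE kE l1 muln1 !inE eqxx !orbT; split=> //; exact/eqP.
have [m1|m1] := leqP m 1; last first.
  have p1 := prime_gt1 pp; have q1 := prime_gt1 pq; have r1 := prime_gt1 pr.
  case: (divisor_graph_chain5_nonplanar n0
    (c := nth 0 [:: 1; p; p * q; p * q * r; n])%N _ _ pl) => //=.
  case=> [|[|[|[|//]]]] _ /=.
  - by rewrite p1 dvd1n.
  - by apply/andP; split; [apply: ltn_Pmulr; rewrite // prime_gt0|exact: dvdn_mulr].
  - by apply/andP; split; [apply: ltn_Pmulr; rewrite // muln_gt0 !prime_gt0|exact: dvdn_mulr].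
  rewrite nE kE lE !mulnA.
  by apply/andP; split; [apply: ltn_Pmulr; rewrite // !muln_gt0 !prime_gt0|exact: dvdn_mulr].
have {m1} m1 : m = 1%N by lia.
have {nE kE lE} nE : n = (p * q * r)%N by rewrite nE kE lE m1 muln1 !mulnA.
have [pqE|npq] := eqVneq p q.
  have [prE|npr] := eqVneq p r.
    have -> : n = (p ^ 3)%N by rewrite nE -pqE -prE !expnS expn0 muln1 mulnA.
    by exists p, q'; rewrite !inE eqxx !orbT.
  exists p, r; rewrite nE -pqE !inE eqxx !orbT; split=> //; exact/eqP.
have [prE|npr] := eqVneq p r.
  exists p, q; rewrite nE -prE mulnAC !inE eqxx !orbT; split=> //; exact/eqP.
have [qrE|nqr] := eqVneq q r.
  exists q, p; rewrite nE -qrE -mulnA mulnC mulnn !inE eqxx !orbT; split=> //.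
  by move/eqP; rewrite eq_sym; apply/negP.
by rewrite nE in pl; case: (divisor_graph_pqr_nonplanar pp pq pr npq npr nqr pl).
Qed.

(** * Straight-line drawings *)

Definition orient (R : pzRingType) (a b c : R * R) : R :=
  (b.1 - a.1) * (c.2 - a.2) - (b.2 - a.2) * (c.1 - a.1).

Definition segment (R : pzRingType) (a b : R * R) (t : R) : R * R :=
  ((1 - t) * a.1 + t * b.1, (1 - t) * a.2 + t * b.2).

Section Segments.

Variable R : realFieldType.
Implicit Types (a b c d : R * R) (s t : R).

Lemma segment0 a b : segment a b 0 = a.
Proof. by case: a b => [a1 a2] [b1 b2]; rewrite /segment /=; congr pair; ring. Qed.

Lemma segment1 a b : segment a b 1 = b.
Proof. by case: a b => [a1 a2] [b1 b2]; rewrite /segment /=; congr pair; ring. Qed.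

Lemma segment_rev a b t : segment b a t = segment a b (1 - t).
Proof. by rewrite /segment /=; congr pair; ring. Qed.

Lemma segment_inj a b : a != b -> injective (segment a b).
Proof.
move=> ab s t [e1 e2]; have [->//|st] := eqVneq s t.
have st0 : s - t != 0 by rewrite subr_eq0.
case/eqP: ab; case: a b e1 e2 => [a1 a2] [b1 b2] /= e1 e2.
by congr pair; apply: (mulfI st0); apply/eqP; rewrite -subr_eq0; apply/eqP; lra.
Qed.

Lemma orient_segment a b c d t :
  orient a b (segment c d t) = (1 - t) * orient a b c + t * orient a b d.
Proof. by rewrite /orient /segment /=; ring. Qed.

Lemma orient_on_segment a b t : orient a b (segment a b t) = 0.
Proof. by rewrite /orient /segment /=; ring. Qed.

(** [orient] is twice the signed area of a triangle: [c] and [d] lie strictly on the same side of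
    the line [ab], hence so does every point between them. *)
Lemma segment_disjoint a b c d s t : t \in `]0, 1[ ->
  0 < orient a b c * orient a b d -> segment a b s != segment c d t.
Proof.
rewrite in_itv /= => /andP[t0 t1] sgn; apply/eqP => /(congr1 (orient a b)).
rewrite orient_on_segment orient_segment => /esym e.
have : orient a b c * ((1 - t) * orient a b c + t * orient a b d) > 0; last first.
  by rewrite e mulr0 ltxx.
have c0 : orient a b c != 0 by apply: contraTneq sgn => ->; rewrite mul0r ltxx.
have : 0 < orient a b c ^+ 2 by rewrite exprn_even_gt0.
nra.
Qed.

Lemma segment_disjoint_common a b d s t : t != 0 ->
  orient a b d != 0 -> segment a b s != segment a d t.
Proof.
move=> t0 o; apply/eqP => /(congr1 (orient a b)); rewrite orient_on_segment orient_segment.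
rewrite (_ : orient a b a = 0); last by rewrite /orient; ring.
by move/esym/eqP; rewrite mulr0 add0r mulf_eq0 (negPf t0) (negPf o).
Qed.

End Segments.

Lemma segment_continuous (R : realType) (a b : R * R) : continuous (segment a b).
Proof.
have affine (x y : R) : continuous (fun t : R => (1 - t) * x + t * y).
  move=> t; apply: cvgD; last by apply: cvgMr_tmp; exact: cvg_id.
  by apply: cvgMr_tmp; apply: cvgB; [exact: cvg_cst|exact: cvg_id].
by move=> t; apply: (cvg_pair (affine a.1 b.1 t) (affine a.2 b.2 t)).
Qed.

(** General position takes care of edges with a common endpoint; for disjoint edges it is enough
    that the ends of one lie strictly on one side of the line through the other. *)
Lemma straight_line_planar (R : realType) (G : sgraph) (pos : G -> R * R) :
  injective pos ->
  (forall x y z, uniq [:: x; y; z] -> orient (pos x) (pos y) (pos z) != 0) ->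
  (forall a b c d, adj a b -> adj c d -> uniq [:: a; b; c; d] ->
     0 < orient (pos a) (pos b) (pos c) * orient (pos a) (pos b) (pos d) \/
     0 < orient (pos c) (pos d) (pos a) * orient (pos c) (pos d) (pos b)) ->
  planar R G.
Proof.
move=> inj gen noncross; exists pos, (fun x y => segment (pos x) (pos y)).
have neq x y : adj x y -> pos x != pos y.
  by apply: contraTneq => /inj->; rewrite adj_irrefl.
have nz (t : R) : t \in `]0, 1[ -> t != 0 by rewrite in_itv /= => /andP[/lt0r_neq0].
have rev01 (t : R) : t \in `]0, 1[ -> 1 - t \in `]0, 1[.
  by rewrite !in_itv /= subr_gt0 gtrBl => /andP[-> ->].
split=> //.
- move=> x y _; exact/continuous_subspaceT/segment_continuous.
- by move=> x y /neq xy s t _ _; apply: segment_inj.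
- by move=> x y _; apply: segment0.
- by move=> x y _; apply: segment1.
- by move=> x y _ t _; apply: segment_rev.
- move=> x y z xy t t01; have xy' := neq x y xy.
  have [->|xz] := eqVneq z x.
    rewrite -{2}(segment0 (pos x) (pos y)) (inj_eq (segment_inj xy')); exact: nz.
  have [->|yz] := eqVneq z y.
    rewrite -{2}(segment1 (pos x) (pos y)) (inj_eq (segment_inj xy')).
    by rewrite eq_sym -subr_eq0; apply/nz/rev01.
  have u : uniq [:: x; y; z].
    by rewrite /= !inE negb_or -(inj_eq inj) xy' ![_ == z]eq_sym xz yz.
  by apply: contraNneq (gen x y z u) => <-; rewrite orient_on_segment.
have common x y v s t : adj x y -> adj x v -> y != v -> t \in `]0, 1[ ->
    segment (pos x) (pos y) s != segment (pos x) (pos v) t.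
  move=> xy xv yv t01; apply: segment_disjoint_common; first exact: nz.
  by apply: gen; rewrite /= !inE negb_or yv andbT -!(inj_eq inj) !neq.
move=> x y u v xy uv ne s t s01 t01.
(* Two edges can share an endpoint in four ways; reversing segments reduces each to a common
   starting point. *)
have [xu|xu] := eqVneq x u.
  subst u; apply: common => //; by apply: contraNneq ne => ->.
have [xv|xv] := eqVneq x v.
  subst v; rewrite (segment_rev (pos x)); apply: common; rewrite ?rev01 // 1?adj_sym //.
  by apply: contraNneq ne => ->; rewrite finset.setUC.
have [yu|yu] := eqVneq y u.
  subst u; rewrite (segment_rev (pos y)); apply: common; rewrite // 1?adj_sym //.
have [yv|yv] := eqVneq y v.
  subst v; rewrite (segment_rev (pos y)) (segment_rev (pos y)).
  by apply: common; rewrite ?rev01 // 1?adj_sym.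
have u4 : uniq [:: x; y; u; v].
  by rewrite /= !inE !negb_or xu xv yu yv /= !andbT -!(inj_eq inj) !neq.
have [o|o] := noncross x y u v xy uv u4; first exact: segment_disjoint.
by rewrite eq_sym; apply: segment_disjoint.
Qed.

(* The divisors of [p ^ 2 * q] are drawn with [1] and [p ^ 2 * q] at indices 0
   and 1, and the path [p ^ 2], [p], [p * q], [q] at indices 2 to 5. *)
Definition drawing_points : seq (int * int) :=
  [:: (0, 10); (0, -10); (1, 0); (2, 1); (3, 0); (4, 1)].

Definition drawing_pos (k : nat) : int * int := nth (0, 0) drawing_points k.

(** The exceptions are the incomparable pairs p^2 and pq, p^2 and q, p and q, in both orders. *)
Definition drawing_adj (i j : nat) : bool :=
  (i != j) && ((i, j) \notin [:: (2, 4); (4, 2); (2, 5); (5, 2); (3, 5); (5, 3)]%N).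

Lemma all_iotaP (P : pred nat) n i : (i < n)%N -> all P (iota 0 n) -> P i.
Proof. by move=> lt_in /allP; apply; rewrite mem_iota. Qed.

Lemma drawing_pos_general i j k : (i < 6)%N -> (j < 6)%N -> (k < 6)%N ->
  uniq [:: i; j; k] -> orient (drawing_pos i) (drawing_pos j) (drawing_pos k) != 0.
Proof.
have : all (fun i => all (fun j => all (fun k => uniq [:: i; j; k] ==>
  (orient (drawing_pos i) (drawing_pos j) (drawing_pos k) != 0))
  (iota 0 6)) (iota 0 6)) (iota 0 6) by vm_compute.
move=> gen i6 j6 k6; apply: implyP.
exact: all_iotaP k6 (all_iotaP j6 (all_iotaP i6 gen)).
Qed.

Lemma drawing_adj_noncrossing a b c d : (a < 6)%N -> (b < 6)%N -> (c < 6)%N ->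
  (d < 6)%N -> drawing_adj a b -> drawing_adj c d -> uniq [:: a; b; c; d] ->
  let o i j k := orient (drawing_pos i) (drawing_pos j) (drawing_pos k) in
  (0 < o a b c * o a b d) || (0 < o c d a * o c d b).
Proof.
pose o i j k := orient (drawing_pos i) (drawing_pos j) (drawing_pos k).
have : all (fun a => all (fun b => drawing_adj a b ==>
    all (fun c => all (fun d => drawing_adj c d && uniq [:: a; b; c; d] ==>
      (0 < o a b c * o a b d) || (0 < o c d a * o c d b))
    (iota 0 6)) (iota 0 6)) (iota 0 6)) (iota 0 6) by vm_compute.
move=> h a6 b6 c6 d6 ab cd u; have := all_iotaP b6 (all_iotaP a6 h).
rewrite ab => {}h; have := all_iotaP d6 (all_iotaP c6 h).
by rewrite cd u.
Qed.

Lemma planar_of_drawing (R : realType) (G : sgraph) (f : G -> nat) :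
  injective f -> (forall x, (f x < 6)%N) ->
  (forall x y, adj x y -> drawing_adj (f x) (f y)) -> planar R G.
Proof.
move=> injf f6 fadj.
pose toR (u : int * int) : R * R := (u.1%:~R, u.2%:~R).
have oE a b c : orient (toR a) (toR b) (toR c) = (orient a b c)%:~R.
  by rewrite /orient /toR /= !rmorphB !rmorphM !rmorphB.
have uf (s : seq G) : uniq s -> uniq (map f s) by rewrite map_inj_uniq.
apply: (@straight_line_planar R G (fun x => toR (drawing_pos (f x)))).
- move=> x y [/intr_inj e1 /intr_inj e2]; apply: injf.
  apply/eqP; rewrite -(nth_uniq (0, 0) (s := drawing_points)) ?f6 //.
  rewrite -[nth _ _ (f x)]/(drawing_pos (f x)) (surjective_pairing (drawing_pos (f x))).
  by rewrite e1 e2 -surjective_pairing.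
- move=> x y z u; rewrite oE intr_eq0; apply: drawing_pos_general => //.
  exact: (uf [:: x; y; z]).
move=> a b c d ab cd u; rewrite !oE -!rmorphM /= !ltr0z; apply/orP.
by apply: drawing_adj_noncrossing; rewrite ?fadj //; apply: (uf [:: a; b; c; d]).
Qed.

Lemma planar_divisor_graph_dvd (R : realType) (p q n : nat) :
  prime p -> prime q -> p != q -> (n %| p ^ 2 * q)%N -> planar R (divisor_graph n).
Proof.
move=> pp pq npq dn.
have n0 : (0 < p ^ 2 * q)%N by rewrite muln_gt0 expn_gt0 !prime_gt0.
have logp d : (d %| p ^ 2 * q)%N -> (logn p d <= 2)%N.
  move=> /(dvdn_leq_log p n0); rewrite lognM ?expn_gt0 ?prime_gt0 // pfactorK //.
  by rewrite (logn_prime _ pq) (negPf npq) addn0.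
have logq d : (d %| p ^ 2 * q)%N -> (logn q d <= 1)%N.
  move=> /(dvdn_leq_log q n0); rewrite lognM ?expn_gt0 ?prime_gt0 // lognX.
  by rewrite (logn_prime _ pp) (logn_prime _ pq) eqxx eq_sym (negPf npq).
(* Position [i + 3 * j] of the table holds the index of p^i q^j in [drawing_points]. *)
pose code (i j : nat) := nth 0%N [:: 0; 3; 2; 5; 4; 1]%N (i + 3 * j).
pose f (d : divisor_graph n) := code (logn p (ssval d)) (logn q (ssval d)).
have dvdd (d : divisor_graph n) : (ssval d %| p ^ 2 * q)%N.
  by apply: (dvdn_trans _ dn); rewrite dvdn_divisors ?(dvdn_gt0 n0 dn) //; exact: ssvalP.
have d0 d : (0 < ssval d)%N := dvdn_gt0 n0 (dvdd d).
have code_inj i j i' j' : (i <= 2)%N -> (i' <= 2)%N -> (j <= 1)%N -> (j' <= 1)%N ->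
    code i j = code i' j' -> i = i' /\ j = j'.
  by case: i => [|[|[|]]] //; case: i' => [|[|[|]]] //; case: j => [|[|]] //;
     case: j' => [|[|]].
have injf : injective f.
  move=> d e /(code_inj _ _ _ _ (logp _ (dvdd d)) (logp _ (dvdd e)) (logq _ (dvdd d))
    (logq _ (dvdd e))) [lp lq]; apply: val_inj; apply: eqn_from_log (d0 d) (d0 e) _ => l.
  have [->|lNp] := eqVneq l p; first exact: lp.
  have [->|lNq] := eqVneq l q; first exact: lq.
  have log0 d' : (d' %| p ^ 2 * q)%N -> logn l d' = 0%N.
    move=> /(dvdn_leq_log l n0); rewrite lognM ?expn_gt0 ?prime_gt0 // lognX.
    by rewrite (logn_prime _ pp) (logn_prime _ pq) (negPf lNp) (negPf lNq) leqn0 => /eqP.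
  by rewrite !log0.
apply: (planar_of_drawing R injf).
  move=> d; rewrite /f; move: (logp _ (dvdd d)) (logq _ (dvdd d)).
  by case: (logn p _) => [|[|[|]]] //; case: (logn q _) => [|[|]].
move=> d e /andP[de cmp]; rewrite /drawing_adj (inj_eq injf) de /=.
have {cmp} : (logn p (ssval d) <= logn p (ssval e))%N && (logn q (ssval d) <= logn q (ssval e))%N ||
  (logn p (ssval e) <= logn p (ssval d))%N && (logn q (ssval e) <= logn q (ssval d))%N.
  by case/orP: cmp => h; apply/orP; [left|right]; rewrite !dvdn_leq_log.
rewrite /f; move: (logp _ (dvdd d)) (logq _ (dvdd d)) (logp _ (dvdd e)) (logq _ (dvdd e)).
by case: (logn p (ssval d)) => [|[|[|]]] //; case: (logn q (ssval d)) => [|[|]] //;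
   case: (logn p (ssval e)) => [|[|[|]]] //; case: (logn q (ssval e)) => [|[|]].
Qed.

(** The graph is K4, and the indices 0 to 3 are pairwise adjacent in [drawing_adj]. *)
Lemma planar_divisor_graph_cube (R : realType) (p : nat) :
  prime p -> planar R (divisor_graph (p ^ 3)).
Proof.
move=> pp; have p30 : (0 < p ^ 3)%N by rewrite expn_gt0 prime_gt0.
have dv (d : divisor_graph (p ^ 3)) : exists2 k, (k <= 3)%N & ssval d = (p ^ k)%N.
  by apply/dvdn_pfactor => //; rewrite dvdn_divisors //; exact: ssvalP.
pose f (d : divisor_graph (p ^ 3)) := logn p (ssval d).
have f3 d : (f d <= 3)%N by rewrite /f; have [k k3 ->] := dv d; rewrite pfactorK.
have injf : injective f.
  move=> d e; rewrite /f => le; apply: val_inj; move: le => /=.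
  by have [k _ ->] := dv d; have [l _ ->] := dv e; rewrite !pfactorK // => ->.
apply: (planar_of_drawing R injf) => [d|d e /andP[de _]].
  exact: leq_trans (f3 d) _.
rewrite /drawing_adj (inj_eq injf) de /=; move: (f3 d) (f3 e).
by case: (f d) => [|[|[|[|]]]] //; case: (f e) => [|[|[|[|]]]].
Qed.

(** * Divisibility of characteristic polynomials *)

Section Determinants.

Variable C : comNzRingType.

(** Sylvester's identity, from two block triangular factorizations of one matrix. *)
Lemma det_add1_mulmxC m n (U : 'M[C]_(m, n)) (V : 'M[C]_(n, m)) :
  \det (1%:M + U *m V) = \det (1%:M + V *m U).
Proof.
have e1 : block_mx 1%:M (- U) V 1%:M =
    block_mx 1%:M 0 V 1%:M *m block_mx 1%:M (- U) 0 (1%:M + V *m U).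
  rewrite mulmx_block !(mul1mx, mul0mx, mulmx0, mulmx1, addr0).
  by rewrite mulmxN addrCA addNr addr0.
have e2 : block_mx 1%:M (- U) V 1%:M =
    block_mx (1%:M + U *m V) (- U) 0 1%:M *m block_mx 1%:M 0 V 1%:M.
  by rewrite mulmx_block !(mul1mx, mul0mx, mulmx0, mulmx1, add0r) mulNmx addrK.
have := congr1 determinant e1; rewrite e2 !det_mulmx !det_ublock !det_lblock.
by rewrite !det1 !mul1r !mulr1.
Qed.

(* [S] intertwines [M] with [A] and splits: [A] is then a diagonal block of [M]
   in suitable coordinates. *)
Lemma det_intertwine k N (M : 'M[C]_N) (A : 'M[C]_k) (S : 'M[C]_(k, N))
    (R : 'M[C]_(N, k)) :
  S *m M = A *m S -> S *m R = 1%:M -> exists h, \det M = h * \det A.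
Proof.
(* Since S M' = S, the matrix [M] equals (1 + R (A - 1) S) M', and Sylvester's identity gives the
   first factor the determinant of [A]. *)
move=> SM SR; pose M' := M - R *m (A - 1%:M) *m S.
have SM' : S *m M' = S.
  by rewrite mulmxBr SM !mulmxA SR mul1mx mulmxBl mul1mx opprB addrC subrK.
exists (\det M').
have <- : \det (1%:M + R *m ((A - 1%:M) *m S)) = \det A.
  by rewrite det_add1_mulmxC -mulmxA SR mulmx1 addrC subrK.
rewrite mulrC -det_mulmx; congr (\det _).
by rewrite mulmxDl mul1mx -!mulmxA SM' mulmxA subrK.
Qed.

End Determinants.

(** * Intertwiners between adjacency matrices *)

Definition funmx (K : Type) (G H : finType) (F : G -> H -> K) : 'M[K]_(#|G|, #|H|) :=
  \matrix_(i, j) F (enum_val i) (enum_val j).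

Lemma sum_enum_val (K : nmodType) (G : finType) (F : G -> K) :
  \sum_(i < #|G|) F (enum_val i) = \sum_x F x.
Proof.
rewrite (reindex (@enum_val G G)) /=; last by apply: onW_bij; apply: enum_val_bij.
by apply: eq_big => // i; rewrite enum_valP.
Qed.

Lemma mul_funmx (K : pzSemiRingType) (G H L : finType) (F : G -> H -> K) (F' : H -> L -> K) :
  funmx F *m funmx F' = funmx (fun x y => \sum_z F x z * F' z y).
Proof.
apply/matrixP=> i j; rewrite !mxE -[RHS]sum_enum_val.
by apply: eq_bigr => k _; rewrite !mxE.
Qed.

Lemma funmx1 (K : pzSemiRingType) (G : finType) :
  funmx (fun x y : G => (x == y)%:R) = 1%:M :> 'M[K]_#|G|.
Proof. by apply/matrixP=> i j; rewrite !mxE (inj_eq enum_val_inj). Qed.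

Lemma adjmxE (K : pzSemiRingType) (G : sgraph) :
  adjmx K G = funmx (fun x y : G => (adj x y)%:R).
Proof. by []. Qed.

Definition intertwines (G H : sgraph) (S : G -> H -> int) : Prop :=
  forall x y, \sum_z S x z * (adj z y)%:R = \sum_z (adj x z)%:R * S z y.

Section Divisibility.

Variables G H : sgraph.

Lemma graph_poly_intertwine k (A : 'M[int]_k) (S : 'M_(k, #|H|)) (R : 'M_(#|H|, k)) :
  S *m adjmx int H = A *m S -> S *m R = 1%:M ->
  zpoly_dvd (\det (map_mx polyC A - 'X%:M)) (graph_poly H).
Proof.
move=> SA SR; apply: (@det_intertwine _ _ _ _ _ (map_mx polyC S) (map_mx polyC R)).
  by rewrite mulmxBr mulmxBl -!map_mxM SA mul_scalar_mx mul_mx_scalar.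
by rewrite -map_mxM SR map_mx1.
Qed.

(** The right inverse [R] has integer entries, so the quotient lies in Z[X]. *)
Lemma graph_poly_dvd (S : G -> H -> int) (R : H -> G -> int) :
  intertwines S -> (forall x y, \sum_z S x z * R z y = (x == y)%:R) ->
  zpoly_dvd (graph_poly G) (graph_poly H).
Proof.
move=> SA SR; apply: (@graph_poly_intertwine _ _ (funmx S) (funmx R)).
  rewrite !adjmxE !mul_funmx; congr funmx.
  by apply/funext => x; apply/funext => y; exact: SA.
rewrite mul_funmx -funmx1; congr funmx.
by apply/funext => x; apply/funext => y; exact: SR.
Qed.

(** Stacked, [S] and [S'] intertwine [H] with two disjoint copies of [G]; the four sum conditions
    make [R] and [R'] side by side a right inverse. *)
Lemma graph_poly_sqr_dvd (S S' : G -> H -> int) (R R' : H -> G -> int) :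
  intertwines S -> intertwines S' ->
  (forall x y, \sum_z S x z * R z y = (x == y)%:R) ->
  (forall x y, \sum_z S' x z * R' z y = (x == y)%:R) ->
  (forall x y, \sum_z S x z * R' z y = 0) ->
  (forall x y, \sum_z S' x z * R z y = 0) ->
  zpoly_dvd (graph_poly G ^+ 2) (graph_poly H).
Proof.
move=> SA SA' SR SR' SR0 SR0'.
have funmxE (F F' : G -> G -> int) : (forall x y, F x y = F' x y) -> funmx F = funmx F'.
  by move=> e; congr funmx; apply/funext => x; apply/funext.
have SAmx F : intertwines F -> funmx F *m adjmx int H = adjmx int G *m funmx F.
  move=> FA; rewrite !adjmxE !mul_funmx; congr funmx.
  by apply/funext => x; apply/funext => y; exact: FA.
have := @graph_poly_intertwine _ (block_mx (adjmx int G) 0 0 (adjmx int G))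
  (col_mx (funmx S) (funmx S')) (row_mx (funmx R) (funmx R')).
rewrite mul_col_mx mul_block_col !mul0mx addr0 add0r !SAmx // mul_col_row.
rewrite !mul_funmx (funmxE _ _ SR) (funmxE _ _ SR') (funmxE _ _ SR0) (funmxE _ _ SR0').
rewrite funmx1 (_ : funmx (fun _ _ => 0) = 0); last by apply/matrixP=> i j; rewrite !mxE.
rewrite -scalar_mx_block => /(_ erefl erefl).
by rewrite map_block_mx !map_mx0 scalar_mx_block opp_block_mx add_block_mx !subr0 det_ublock.
Qed.

End Divisibility.

Lemma zpoly_dvd_trans f g h : zpoly_dvd f g -> zpoly_dvd g h -> zpoly_dvd f h.
Proof. by move=> [u ->] [v ->]; exists (v * u); rewrite mulrA. Qed.

Lemma zpoly_dvd_sqr f g : zpoly_dvd f g -> zpoly_dvd (f ^+ 2) (g ^+ 2).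
Proof. by move=> [u ->]; exists (u ^+ 2); rewrite exprMn. Qed.

Lemma sum_delta (K : pzSemiRingType) (T : finType) (F : T -> K) x :
  \sum_y F y * (y == x)%:R = F x.
Proof.
rewrite (bigD1 x) //= eqxx mulr1 big1 ?addr0 // => y /negPf ->.
by rewrite mulr0.
Qed.

Lemma sum_delta_l (K : pzSemiRingType) (T : finType) (F : T -> K) x :
  \sum_y (x == y)%:R * F y = F x.
Proof.
rewrite (bigD1 x) //= eqxx mul1r big1 ?addr0 // => y; rewrite eq_sym => /negPf ->.
by rewrite mul0r.
Qed.

Lemma graph_iso_poly_dvd (G H : sgraph) (g : G -> H) :
  graph_iso g -> zpoly_dvd (graph_poly G) (graph_poly H).
Proof.
case=> -[g' gK gK'] gadj.
have gE x y : (g x == y) = (x == g' y) by rewrite -(can_eq gK') gK.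
apply: (@graph_poly_dvd _ _ (fun x y => (g x == y)%:R) (fun y x => (g x == y)%:R)) => x y.
  rewrite sum_delta_l; under eq_bigr do rewrite gE.
  by rewrite sum_delta -gadj gK'.
by rewrite sum_delta_l eq_sym (can_eq gK).
Qed.

Lemma graph_iso_sym (G H : sgraph) (g : G -> H) :
  graph_iso g -> exists g' : H -> G, graph_iso g'.
Proof.
case=> -[g' gK gK'] gadj; exists g'; split; first by exists g.
by move=> x y; rewrite -gadj !gK'.
Qed.

Lemma graph_eigenvalue_dvd (R : realType) (G H : sgraph) (a : R) :
  zpoly_dvd (graph_poly G) (graph_poly H) -> graph_eigenvalue G a -> graph_eigenvalue H a.
Proof.
have rootE (L : sgraph) : graph_eigenvalue L a <-> root (map_poly intr (graph_poly L)) a.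
  rewrite /graph_eigenvalue eigenvalue_root_char /char_poly /char_poly_mx.
  rewrite /graph_poly -det_map_mx map_mxB map_scalar_mx /= map_polyX.
  have -> : map_mx (map_poly intr) (map_mx polyC (adjmx int L)) =
      map_mx polyC (adjmx R L).
    by apply/matrixP=> i j; rewrite !mxE map_polyC /= rmorph_nat.
  (* The determinants of A - X and X - A differ by a power of -1, a constant without roots. *)
  rewrite -opprB -scaleN1r detZ rootM -polyCN -polyC_exp rootC.
  by rewrite expf_eq0 oppr_eq0 oner_eq0 andbF.
move=> [h hE] /rootE ra; apply/rootE.
by rewrite hE rmorphM /= rootM ra orbT.
Qed.

(** Row [x] is the difference of the unit vectors at [u x] and [w x], so only the neighbours of
    these two vertices need comparing. *)
Lemma intertwines_difference (G H : sgraph) (pi : H -> G) (sigma : H -> int) (u w : G -> H) :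
  (forall x z, (x == pi z)%:R * sigma z = (u x == z)%:R - (w x == z)%:R) ->
  (forall x y, (adj (u x) y)%:R - (adj (w x) y)%:R = (adj x (pi y))%:R * sigma y) ->
  intertwines (fun x z => (x == pi z)%:R * sigma z).
Proof.
move=> S_uw adj_uw x y.
under eq_bigr do rewrite S_uw mulrBl.
rewrite sumrB !sum_delta_l adj_uw.
by under eq_bigr do rewrite mulrA; rewrite -mulr_suml sum_delta.
Qed.

Local Notation bool_ext le := (prod_le le nat_of_bool).

Lemma comparability_poly_dvd2 (T : finType) (le : rel T) :
  zpoly_dvd (graph_poly (comparability_graph le))
    (graph_poly (comparability_graph (bool_ext (bool_ext le)))).
Proof.
pose G := comparability_graph le; pose H := comparability_graph (bool_ext (bool_ext le)).
(* On the two added factors [sigma] is e_p - e_q; the right inverse reads off the coordinate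
   [(x, true, false)], where [sigma] is 1. *)
pose pi (z : H) : G := z.1.1; pose sigma (z : H) : int := z.1.2%:R - z.2%:R.
apply: (@graph_poly_dvd G H (fun x z => (x == pi z)%:R * sigma z)
  (fun z x => (z == (x, true, false))%:R)); last first.
  by move=> x y; rewrite sum_delta /pi /sigma /= subr0 mulr1.
apply: (@intertwines_difference G H pi sigma
  (fun x => (x, true, false)) (fun x => (x, false, true))) => x [[z b] c].
  by rewrite /pi /sigma !xpair_eqE /=; case: b c => [] []; case: (x == z).
rewrite /pi /sigma /= /comparable_adj /prod_le !xpair_eqE /=.
by case: b c => [] [] /=; case: (x == z); case: (le x z); case: (le z x).
Qed.

Lemma comparability_poly_sqr_dvd3 (T : finType) (le : rel T) :
  zpoly_dvd (graph_poly (comparability_graph (bool_ext le)) ^+ 2)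
    (graph_poly (comparability_graph (bool_ext (bool_ext (bool_ext le))))).
Proof.
pose G := comparability_graph (bool_ext le).
pose H := comparability_graph (bool_ext (bool_ext (bool_ext le))).
pose pi (z : H) : G := z.1.1; pose sigma (z : H) : int := z.1.2%:R - z.2%:R.
pose pi' (z : H) : G := (z.1.1.1, z.1.2); pose sigma' (z : H) : int := z.2%:R - z.1.1.2%:R.
(* In [z = (t, r, p, q)] the map [sigma] is antisymmetric in [p, q] and [sigma'] in
   [q, r]; [R] and [R'] form a dual basis supported on coordinates with [q = r],
   resp. [q = p]. *)
pose R (z : H) (x : G) : int := (z == (x.1, x.2, ~~ x.2, x.2))%:R * (-1) ^+ x.2.
pose R' (z : H) (x : G) : int := (z == (x.1, ~~ x.2, x.2, x.2))%:R * (-1) ^+ (~~ x.2).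
have sumR (F : H -> int) z (e : int) :
    \sum_y F y * ((y == z)%:R * e) = F z * e.
  by under eq_bigr do rewrite mulrA; rewrite -mulr_suml sum_delta.
have G_eq (x y : G) : (x == y) = (x.1 == y.1) && (x.2 == y.2) by rewrite -pair_eqE.
apply: (@graph_poly_sqr_dvd G H (fun x z => (x == pi z)%:R * sigma z)
  (fun x z => (x == pi' z)%:R * sigma' z) R R').
- apply: (@intertwines_difference G H pi sigma
    (fun x => (x, true, false)) (fun x => (x, false, true))) => -[x a] [[[z a'] b] c].
    rewrite /pi /sigma !xpair_eqE /=.
    by case: b c => [] []; case: (x == z); case: (a == a').
  rewrite /pi /sigma /= /comparable_adj /prod_le !xpair_eqE /=.
  by case: a b c a' => [] [] [] [] /=; case: (x == z); case: (le x z); case: (le z x).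
- apply: (@intertwines_difference G H pi' sigma'
    (fun x => (x.1, false, x.2, true)) (fun x => (x.1, true, x.2, false))) =>
    -[x a] [[[z b] a'] c].
    rewrite /pi' /sigma' !xpair_eqE /=.
    by case: b c => [] []; case: (x == z); case: (a == a').
  rewrite /pi' /sigma' /= /comparable_adj /prod_le !xpair_eqE /=.
  by case: a b c a' => [] [] [] [] /=; case: (x == z); case: (le x z); case: (le z x).
- move=> x [y b]; rewrite sumR G_eq /pi /sigma /=.
  by case: b; rewrite ?eqb_id; case: (x.1 == y); case: (x.2).
- move=> x [y b]; rewrite sumR G_eq /pi' /sigma' /=.
  by case: b; case: (x.1 == y); case: (x.2).
- move=> x [y b]; rewrite sumR /pi /sigma /=.
  by rewrite subrr mulr0 mul0r.
- move=> x [y b]; rewrite sumR /pi' /sigma' /=.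
  by rewrite subrr mulr0 mul0r.
Qed.

Lemma divisor_poset_poly_dvd n (T : finType) (le : rel T) : (0 < n)%N -> divisor_poset n le ->
  zpoly_dvd (graph_poly (comparability_graph le)) (graph_poly (divisor_graph n)) /\
  zpoly_dvd (graph_poly (divisor_graph n)) (graph_poly (comparability_graph le)).
Proof.
move=> n0 /(divisor_poset_iso n0)[g iso_g]; split; first exact: graph_iso_poly_dvd iso_g.
by have [g' iso_g'] := graph_iso_sym iso_g; exact: graph_iso_poly_dvd iso_g'.
Qed.

Lemma divisor_poset_mul2 n (T : finType) (le : rel T) p q : (0 < n)%N ->
  divisor_poset n le -> prime p -> prime q -> p != q -> ~~ (p %| n)%N -> ~~ (q %| n)%N ->
  divisor_poset (n * p * q) (bool_ext (bool_ext le)).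
Proof.
move=> n0 dn pp pq npq pn qn; apply: divisor_poset_mul_prime => //.
- by rewrite muln_gt0 n0 prime_gt0.
- exact: divisor_poset_mul_prime.
by rewrite Euclid_dvdM // negb_or qn dvdn_prime2 // eq_sym.
Qed.

Lemma divisor_graph_poly_dvd n p q : (0 < n)%N -> prime p -> prime q -> p != q ->
  ~~ (p %| n)%N -> ~~ (q %| n)%N ->
  zpoly_dvd (graph_poly (divisor_graph n)) (graph_poly (divisor_graph (n * p * q))).
Proof.
move=> n0 pp pq npq pn qn; have dn := divisor_posetP n0.
have npq0 : (0 < n * p * q)%N by rewrite !muln_gt0 n0 !prime_gt0.
have [_ d1] := divisor_poset_poly_dvd n0 dn.
have [d2 _] := divisor_poset_poly_dvd npq0 (divisor_poset_mul2 n0 dn pp pq npq pn qn).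
exact: zpoly_dvd_trans d1 (zpoly_dvd_trans (comparability_poly_dvd2 _) d2).
Qed.

Lemma divisor_graph_poly_sqr_dvd m r p q : (0 < m)%N -> prime r -> ~~ (r %| m)%N ->
  prime p -> prime q -> p != q -> ~~ (p %| m * r)%N -> ~~ (q %| m * r)%N ->
  zpoly_dvd (graph_poly (divisor_graph (m * r)) ^+ 2)
    (graph_poly (divisor_graph (m * r * p * q))).
Proof.
move=> m0 pr rm pp pq npq pn qn.
have n0 : (0 < m * r)%N by rewrite muln_gt0 m0 prime_gt0.
have dn := divisor_poset_mul_prime m0 (divisor_posetP m0) pr rm.
have npq0 : (0 < m * r * p * q)%N by rewrite !muln_gt0 m0 !prime_gt0.
have [_ /zpoly_dvd_sqr d1] := divisor_poset_poly_dvd n0 dn.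
have [d2 _] := divisor_poset_poly_dvd npq0 (divisor_poset_mul2 n0 dn pp pq npq pn qn).
exact: zpoly_dvd_trans d1 (zpoly_dvd_trans (comparability_poly_sqr_dvd3 _) d2).
Qed.

(** * Eigenvalues *)

Section Eigenfunctions.

Variable R : realType.

Lemma graph_eigenvalueP (G : sgraph) (a : R) : graph_eigenvalue G a <->
  exists f : G -> R, (exists x, f x != 0) /\
    forall x, \sum_y (adj x y)%:R * f y = a * f x.
Proof.
split=> [/eigenvalueP[v vA v0]|[f [[x fx] fA]]].
  exists (fun x => v 0 (enum_rank x)); split.
    have [i vi] : exists i, v 0 i != 0.
      apply/existsP; apply: contraNT v0 => /existsPn h; apply/eqP/rowP => i.
      by rewrite mxE; apply/eqP; rewrite -[_ == _]negbK h.
    by exists (enum_val i); rewrite enum_valK.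
  move=> x; move/rowP/(_ (enum_rank x)): vA; rewrite !mxE => <-.
  rewrite -sum_enum_val; apply: eq_bigr => i _.
  by rewrite !mxE enum_rankK enum_valK mulrC adj_sym.
apply/eigenvalueP; exists (\row_i f (enum_val i)).
  apply/rowP => j; rewrite !mxE -fA -[RHS]sum_enum_val; apply: eq_bigr => i _.
  by rewrite !mxE mulrC adj_sym.
apply: contraNneq fx => /rowP/(_ (enum_rank x)).
by rewrite !mxE enum_rankK => ->.
Qed.

(** The sum of the zeta matrix and its transpose counts the diagonal twice, whence the shift by
    2. *)
Lemma comparability_eigenvalueP (T : finType) (le : rel T) (a : R) :
  reflexive le -> antisymmetric le ->
  graph_eigenvalue (comparability_graph le) a <->
  exists f : T -> R, (exists x, f x != 0) /\ forall x,
    \sum_y (le x y)%:R * f y + \sum_y (le y x)%:R * f y = (a + 2) * f x.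
Proof.
move=> le_refl le_anti.
have sumE (f : T -> R) x : \sum_y (comparable_adj le x y)%:R * f y =
    \sum_y (le x y)%:R * f y + \sum_y (le y x)%:R * f y - 2 * f x.
  rewrite -(sum_delta_l f x) mulr_sumr -big_split -sumrB /=; apply: eq_bigr => y _.
  rewrite /comparable_adj; have [->|xy] := eqVneq x y; first by rewrite le_refl /=; ring.
  case lexy : (le x y); case leyx : (le y x) => /=; try ring.
  by case/eqP: xy; apply: le_anti; rewrite lexy.
split=> [/graph_eigenvalueP[f [f0 fA]]|[f [f0 fA]]].
  by exists f; split=> // x; rewrite mulrDl -fA /= sumE subrK.
by apply/graph_eigenvalueP; exists f; split=> // x; rewrite /= sumE fA; ring.
Qed.

Lemma divisor_poset_eigenvalue n (T : finType) (le : rel T) (a : R) : (0 < n)%N ->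
  divisor_poset n le ->
  graph_eigenvalue (divisor_graph n) a <-> graph_eigenvalue (comparability_graph le) a.
Proof.
by move=> n0 /(divisor_poset_poly_dvd n0)[d1 d2]; split; exact: graph_eigenvalue_dvd.
Qed.

(** Both 1 and [n] are adjacent to all other vertices, so the difference of their unit vectors is an
    eigenvector. *)
Lemma divisor_graph_eigenvalueN1 n : (2 <= n)%N -> graph_eigenvalue (divisor_graph n) (-1 : R).
Proof.
move=> n2; have n0 : (0 < n)%N by lia.
have d1 : 1%N \in divisors n by rewrite -dvdn_divisors.
have dn : n \in divisors n by rewrite -dvdn_divisors.
pose u : divisor_graph n := SeqSub d1; pose w : divisor_graph n := SeqSub dn.
have uw : u != w by rewrite -val_eqE /= ltn_eqF.
have dvx (x : divisor_graph n) : (ssval x %| n)%N by rewrite dvdn_divisors //; exact: ssvalP.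
have adju x : (adj x u) = (x != u) by rewrite /= /divisor_adj /= dvd1n orbT andbT.
have adjw x : (adj x w) = (x != w) by rewrite /= /divisor_adj /= dvx andbT.
apply/graph_eigenvalueP; exists (fun x => (x == u)%:R - (x == w)%:R); split.
  by exists u; rewrite eqxx (negPf uw) subr0 oner_eq0.
move=> x; under eq_bigr do rewrite mulrBr.
rewrite sumrB !sum_delta adju adjw.
by case: (x == u); case: (x == w); rewrite /=; ring.
Qed.

End Eigenfunctions.

Lemma divisor_poset_refl n (T : finType) (le : rel T) : divisor_poset n le -> reflexive le.
Proof. by move=> [f [_ fle _]] x; rewrite -fle. Qed.

Lemma divisor_poset_anti n (T : finType) (le : rel T) : divisor_poset n le -> antisymmetric le.
Proof. by move=> [f [injf fle _]] x y; rewrite -!fle -eqn_dvd => /eqP/injf. Qed.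

Lemma sum_pair_bool (K : nmodType) (T : finType) (F : T * bool -> K) :
  \sum_z F z = \sum_t (F (t, true) + F (t, false)).
Proof.
transitivity (\sum_t \sum_b F (t, b)).
  by rewrite pair_bigA /=; apply: eq_bigr => -[].
by apply: eq_bigr => t _; rewrite big_bool.
Qed.

Lemma sum_unit (K : nmodType) (F : unit -> K) : \sum_z F z = F tt.
Proof. by rewrite (big_pred1 tt) // => -[]. Qed.

(** * Eigenvalues for squarefree numbers *)

Section Squarefree.

Variable R : realType.

Lemma divisor_poset_eigenfunction n (T : finType) (le : rel T) (a : R) (f : T -> R) x :
  (0 < n)%N -> divisor_poset n le -> f x != 0 ->
  (forall x, \sum_y (le x y)%:R * f y + \sum_y (le y x)%:R * f y = (a + 2) * f x) ->
  graph_eigenvalue (divisor_graph n) a.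
Proof.
move=> n0 dn fx fA; apply/(divisor_poset_eigenvalue a n0 dn)/comparability_eigenvalueP.
- exact: divisor_poset_refl dn.
- exact: divisor_poset_anti dn.
by exists f; split; first by exists x.
Qed.

Lemma divisor_graph1_eigenvalue : graph_eigenvalue (divisor_graph 1) (0 : R).
Proof.
apply: (divisor_poset_eigenfunction (f := fun=> 1) (x := tt) _ divisor_poset1) => //.
by move=> x; rewrite !sum_unit /=; ring.
Qed.

Lemma divisor_graph_prime_eigenvalue p : prime p -> graph_eigenvalue (divisor_graph p) (1 : R).
Proof.
move=> pp; have p1 : ~~ (p %| 1)%N by rewrite dvdn1 gtn_eqF ?prime_gt1.
have := divisor_poset_mul_prime (ltn0Sn 0) divisor_poset1 pp p1; rewrite mul1n => dp.
apply: (divisor_poset_eigenfunction (f := fun=> 1) (x := (tt, true)) _ dp).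
- exact: prime_gt0.
- exact: oner_neq0.
by move=> [[] []]; rewrite !sum_pair_bool !sum_unit /prod_le /=; ring.
Qed.

(* The eigenfunction alternates on the hexagon of the primes and of the products
   of two primes, and vanishes at [1] and [p * q * r]. *)
Lemma divisor_graph_pqr_eigenvalue p q r : prime p -> prime q -> prime r ->
  p != q -> p != r -> q != r -> graph_eigenvalue (divisor_graph (p * q * r)) (-2 : R).
Proof.
move=> pp pq pr npq npr nqr.
have p1 : ~~ (p %| 1)%N by rewrite dvdn1 gtn_eqF ?prime_gt1.
have qp : ~~ (q %| p)%N by rewrite dvdn_prime2 // eq_sym.
have rp : ~~ (r %| p)%N by rewrite dvdn_prime2 // eq_sym.
have := divisor_poset_mul_prime (ltn0Sn 0) divisor_poset1 pp p1; rewrite mul1n => dp.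
have dpqr := divisor_poset_mul2 (prime_gt0 pp) dp pq pr nqr qp rp.
pose f (x : unit * bool * bool * bool) : R :=
  nth 0 [:: 0; 1; -1; 0] (x.1.1.2 + x.1.2 + x.2)%N.
apply: (divisor_poset_eigenfunction (f := f) (x := (tt, true, false, false)) _ dpqr).
- by rewrite !muln_gt0 !prime_gt0.
- exact: oner_neq0.
move=> [[[[] a] b] c]; rewrite !sum_pair_bool !sum_unit /prod_le /f /=.
by case: a b c => [] [] [] /=; ring.
Qed.

Lemma prime_dvd_prod (p : nat) (ps : seq nat) : prime p -> all prime ps ->
  (p %| \prod_(q <- ps) q)%N -> p \in ps.
Proof.
move=> pp; elim: ps => [_|q ps IH /= /andP[pq pps]].
  by rewrite big_nil dvdn1 => /eqP p1; rewrite p1 in pp.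
rewrite big_cons Euclid_dvdM // inE dvdn_prime2 // => /orP[->//|/(IH pps) ->].
by rewrite orbT.
Qed.

Lemma prod_primes_gt0 (ps : seq nat) : all prime ps -> (0 < \prod_(q <- ps) q)%N.
Proof.
by move=> /allP pps; rewrite big_seq prodn_cond_gt0 // => q /pps /prime_gt0.
Qed.

(** The inductive step keeps the parity of the number of primes; the base cases are 1 for the
    eigenvalue 0, a prime for 1, and three primes for -2. *)
Lemma eigenvalue_prod_primes2 p q ps (a : R) : uniq [:: p, q & ps] ->
  all prime [:: p, q & ps] ->
  graph_eigenvalue (divisor_graph (\prod_(r <- ps) r)) a ->
  graph_eigenvalue (divisor_graph (\prod_(r <- [:: p, q & ps]) r)) a.
Proof.
rewrite /= inE negb_or => /and3P[/andP[npq pps] qps _] /and3P[pp pq aps].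
rewrite !big_cons mulnA mulnC mulnA; apply: graph_eigenvalue_dvd.
apply: divisor_graph_poly_dvd => //; first exact: prod_primes_gt0.
  by apply: contra pps; apply: prime_dvd_prod.
by apply: contra qps; apply: prime_dvd_prod.
Qed.

Lemma eigenvalue_even_primes k (ps : seq nat) : size ps = k.*2 -> uniq ps -> all prime ps ->
  graph_eigenvalue (divisor_graph (\prod_(q <- ps) q)) (0 : R).
Proof.
elim: k ps => [|k IH] [|p [|q ps]] //.
  by rewrite big_nil => _ _ _; exact: divisor_graph1_eigenvalue.
move=> [sz] u pr; apply: eigenvalue_prod_primes2 => //; apply: IH => //.
  by case/and3P: u.
by case/and3P: pr.
Qed.

Lemma eigenvalue1_odd_primes k (ps : seq nat) : size ps = k.*2.+1 -> uniq ps -> all prime ps ->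
  graph_eigenvalue (divisor_graph (\prod_(q <- ps) q)) (1 : R).
Proof.
elim: k ps => [|k IH] [|p [|q ps]] //.
  by move=> _ _ /andP[pp _]; rewrite big_seq1; exact: divisor_graph_prime_eigenvalue.
move=> [sz] u pr; apply: eigenvalue_prod_primes2 => //; apply: IH => //.
  by case/and3P: u.
by case/and3P: pr.
Qed.

Lemma eigenvalueN2_odd_primes k (ps : seq nat) : size ps = k.*2.+3 -> uniq ps -> all prime ps ->
  graph_eigenvalue (divisor_graph (\prod_(q <- ps) q)) (-2 : R).
Proof.
elim: k ps => [|k IH] [|p [|q [|r ps]]] //.
  move=> [/size0nil ->] /=; rewrite !inE negb_or => /and3P[/andP[npq npr] nqr _].
  move=> /and4P[pp pq pr _]; rewrite !big_cons big_nil muln1 mulnA.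
  exact: divisor_graph_pqr_eigenvalue.
move=> [sz] u pr; apply: eigenvalue_prod_primes2 => //; apply: IH => //=.
- by rewrite sz.
- by case/and3P: u.
by case/and3P: pr.
Qed.

Lemma squarefree_prod_primes n : (0 < n)%N -> squarefree n -> n = (\prod_(p <- primes n) p)%N.
Proof.
move=> n0 /allP sq; rewrite [LHS]prod_prime_decomp // prime_decompE big_map.
by rewrite big_seq [RHS]big_seq; apply: eq_bigr => p /sq /eqP ->; rewrite expn1.
Qed.

Lemma all_prime_primes n : all prime (primes n).
Proof. by apply/allP => p; rewrite mem_primes => /andP[]. Qed.

Lemma moebius1_eigenvalue n : (0 < n)%N -> moebius n = 1 ->
  graph_eigenvalue (divisor_graph n) (0 : R).
Proof.
rewrite /moebius => n0; case: ifP => // sq; rewrite -signr_odd.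
case odd_ps: (odd _) => // _; rewrite (squarefree_prod_primes n0 sq).
apply: (@eigenvalue_even_primes (size (primes n))./2); rewrite ?primes_uniq ?all_prime_primes //.
by rewrite -[LHS]odd_double_half odd_ps.
Qed.

Lemma moebiusN1_eigenvalue n : (0 < n)%N -> moebius n = -1 -> (2 <= Omega n)%N ->
  graph_eigenvalue (divisor_graph n) (-2 : R) /\ graph_eigenvalue (divisor_graph n) (1 : R).
Proof.
rewrite /moebius => n0; case: ifP => // sq; rewrite -signr_odd.
case odd_ps: (odd _) => // _ om.
have omE : Omega n = size (primes n).
  rewrite /Omega -sum1_size big_seq [RHS]big_seq.
  by apply: eq_bigr => p /(allP sq) /eqP.
have := odd_double_half (size (primes n)); rewrite odd_ps -omE.
(* An odd number of primes that is at least 2 is at least 3, so the half is positive. *)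
case hE : (Omega n)./2 => [|k]; first by move=> /= e; rewrite -e in om.
rewrite doubleS => e; rewrite (squarefree_prod_primes n0 sq); split.
  by apply: (@eigenvalueN2_odd_primes k); rewrite ?primes_uniq ?all_prime_primes // -omE -e.
by apply: (@eigenvalue1_odd_primes k.+1); rewrite ?primes_uniq ?all_prime_primes // -omE -e.
Qed.

End Squarefree.

(** * Two primes and a recurrence of period 6 *)

Section TwoPrimes.

Variable R : realType.

Lemma sum_ord_ge n i (g : nat -> R) :
  \sum_(k < n) (i <= k)%:R * g k = \sum_(i <= k < n) g k.
Proof.
rewrite big_geq_mkord [RHS]big_mkcond; apply: eq_bigr => k _ /=.
by case: leqP; rewrite ?mul1r ?mul0r.
Qed.

Lemma sum_ord_le n i (g : nat -> R) : (i < n)%N ->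
  \sum_(k < n) (k <= i)%:R * g k = \sum_(0 <= k < i.+1) g k.
Proof.
move=> lt_in; rewrite big_mkord (big_ord_widen n g lt_in) [RHS]big_mkcond.
by apply: eq_bigr => k _; rewrite ltnS; case: leqP; rewrite ?mul1r ?mul0r.
Qed.

Lemma sum_pair (A B : finType) (F : A * B -> R) : \sum_z F z = \sum_x \sum_y F (x, y).
Proof. by rewrite pair_bigA /=; apply: eq_bigr => -[]. Qed.

(* [hexagonal n] is [2 / sqrt 3] times the sine of [n * pi / 3]. *)
Definition hexagonal (n : nat) : R := nth 0 [:: 0; 1; 1; 0; -1; -1] (n %% 6).

Lemma hexagonal_congr m n : m = n %[mod 6] -> hexagonal m = hexagonal n.
Proof. by rewrite /hexagonal => ->. Qed.

(** Periodicity reduces a claim on three consecutive values to six numerical cases. *)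
Lemma hexagonal_residue (P : R -> R -> R -> Prop) n :
  (forall r, (r < 6)%N -> P (hexagonal r) (hexagonal r.+1) (hexagonal r.+2)) ->
  P (hexagonal n) (hexagonal n.+1) (hexagonal n.+2).
Proof.
move=> h; have := h _ (ltn_pmod n (isT : (0 < 6)%N)).
rewrite (hexagonal_congr (modn_mod n 6)) (@hexagonal_congr (n %% 6).+1 n.+1); last first.
  by rewrite -addn1 modnDml addn1.
by rewrite (@hexagonal_congr (n %% 6).+2 n.+2) // -addn2 modnDml addn2.
Qed.

(** Writing each value as a difference makes the sums below telescope. *)
Lemma hexagonal_step n : hexagonal n = hexagonal n.+1 - hexagonal n.+2.
Proof.
apply: (hexagonal_residue (P := fun x y z => x = y - z)).
by rewrite /hexagonal; case=> [|[|[|[|[|[|//]]]]]] _ /=; ring.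
Qed.

Lemma hexagonal_add3 n : hexagonal (n + 3) = - hexagonal n.
Proof. by have := hexagonal_step n; have := hexagonal_step n.+1; rewrite addn3; lra. Qed.

Lemma sum_hexagonal c i n : (i <= n)%N ->
  \sum_(i <= k < n) hexagonal (k + c) = hexagonal (i + c).+1 - hexagonal (n + c).+1.
Proof.
move=> le_in; rewrite -opprB -(telescope_sumr (fun k => hexagonal (k + c).+1)) // -sumrN.
by apply: eq_bigr => k _; rewrite hexagonal_step opprB addSn.
Qed.

(** As 5 is -1 modulo 6, the index runs backwards, and the ends of the telescoping sum trade signs
    compared with [sum_hexagonal]. *)
Lemma sum_hexagonal5 c j n : (j <= n)%N ->
  \sum_(j <= l < n) hexagonal (c + 5 * l) =
  hexagonal (c + 5 * n).+2 - hexagonal (c + 5 * j).+2.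
Proof.
move=> le_jn; rewrite -(telescope_sumr (fun l => hexagonal (c + 5 * l).+2)) //.
apply: eq_bigr => l _; rewrite hexagonal_step; congr (_ - _).
by apply: hexagonal_congr; lia.
Qed.

Lemma divisor_poset_two_primes p q a b : prime p -> prime q -> p != q ->
  divisor_poset (p ^ a * q ^ b) (prod_le (prod_le (fun _ _ : unit => true)
    (@nat_of_ord a.+1)) (@nat_of_ord b.+1)).
Proof.
move=> pp pq npq; have p1 : ~~ (p %| 1)%N by rewrite dvdn1 gtn_eqF ?prime_gt1.
have := divisor_poset_mul_pexp a (ltn0Sn 0) divisor_poset1 pp p1; rewrite mul1n => dp.
apply: divisor_poset_mul_pexp => //; first by rewrite expn_gt0 prime_gt0.
by rewrite Euclid_dvdX // dvdn_prime2 // eq_sym (negPf npq).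
Qed.

(* The eigenfunction takes the value [hexagonal (i - j)] at [p ^ i * q ^ j];
   [5] stands for [-1] modulo 6. *)
Lemma divisor_graph_two_primes_eigenvalue p q a b : prime p -> prime q -> p != q ->
  (1 <= a)%N -> a = 1 %[mod 6] -> b = 1 %[mod 6] ->
  graph_eigenvalue (divisor_graph (p ^ a * q ^ b)) (0 : R).
Proof.
move=> pp pq npq a0 a1 b1.
pose f (x : unit * 'I_a.+1 * 'I_b.+1) : R := hexagonal (x.1.2 + 5 * x.2).
apply: (divisor_poset_eigenfunction (f := f) (x := (tt, inord 1, ord0)) _
  (divisor_poset_two_primes a b pp pq npq)).
- by rewrite muln_gt0 !expn_gt0 !prime_gt0.
- by rewrite /f /= inordK // /hexagonal oner_neq0.
case=> -[[] i] j; rewrite !sum_pair !sum_unit /f /prod_le /=.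
under eq_bigr => k _.
  under eq_bigr do rewrite -mulnb natrM -mulrA.
  rewrite -mulr_sumr (sum_ord_ge _ j (fun l => hexagonal (k + 5 * l))).
  rewrite sum_hexagonal5 ?(ltnW (ltn_ord j)) //; over.
rewrite (sum_ord_ge _ i (fun k => hexagonal (k + 5 * b.+1).+2 - hexagonal (k + 5 * j).+2)).
under [X in _ + X]eq_bigr => k _.
  under eq_bigr do rewrite -mulnb natrM -mulrA.
  rewrite -mulr_sumr (sum_ord_le (fun l => hexagonal (k + 5 * l))) //.
  rewrite sum_hexagonal5 //; over.
rewrite (sum_ord_le (fun k => hexagonal (k + 5 * j.+1).+2 - hexagonal (k + 5 * 0).+2)) //.
rewrite !sumrB.
have shift m c n : (m <= n)%N -> \sum_(m <= k < n) hexagonal (k + c).+2 =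
    hexagonal (m + c).+3 - hexagonal (n + c).+3.
  by move=> mn; under eq_bigr do rewrite -!addnS; rewrite sum_hexagonal // !addnS.
rewrite !shift ?(ltnW (ltn_ord i)) //.
move: (nat_of_ord i) (nat_of_ord j) => {f}i {}j {shift}.
(* The congruences on [a] and [b] enter here. Of the eight boundary terms four cancel in pairs, two
   are [hexagonal 3], which is 0, and two are [- hexagonal (i + 5 * j + 3)], that is
   [hexagonal (i + 5 * j)]. *)
rewrite (@hexagonal_congr (i + _ * _.+1).+3 (i + 1)); last by lia.
rewrite (@hexagonal_congr (a.+1 + _).+3 3); last by lia.
rewrite (@hexagonal_congr (i + _ * j).+3 (i + 5 * j + 3)); last by lia.
rewrite (@hexagonal_congr (a.+1 + _).+3 (5 * j + 5)); last by lia.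
rewrite (@hexagonal_congr (0 + _ * _.+1).+3 (5 * j + 5 + 3)); last by lia.
rewrite (@hexagonal_congr (i.+1 + _ * _.+1).+3 (i + 5 * j + 3)); last by lia.
rewrite (@hexagonal_congr (i.+1 + _).+3 (i + 1 + 3)); last by lia.
rewrite !hexagonal_add3 /hexagonal /=.
by ring.
Qed.

(** The matrix with rows (1, -1) and (1, 0); its characteristic polynomial is X^2 - X + 1, so it has
    order 6. *)
Definition hexagonal_turn (u : R * R) : R * R := (u.1 - u.2, u.1).

Lemma iter_hexagonal_turn n u :
  iter n hexagonal_turn u = iter (n %% 6) hexagonal_turn u.
Proof.
rewrite {1}(divn_eq n 6) addnC iterD; congr (iter _ _ _).
elim: (n %/ 6)%N => [//|k IH]; rewrite mulSn iterD IH.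
by case: u {IH} => x y; rewrite /= /hexagonal_turn /=; congr pair; ring.
Qed.

Lemma divisor_graph_prime_pexp_eigenvalue p q a : prime p -> prime q -> p != q ->
  graph_eigenvalue (divisor_graph (p * q ^ a)) (0 : R) -> a = 1 %[mod 6].
Proof.
move=> pp pq npq; have p1 : ~~ (p %| 1)%N by rewrite dvdn1 gtn_eqF ?prime_gt1.
have := divisor_poset_mul_prime (ltn0Sn 0) divisor_poset1 pp p1; rewrite mul1n => dp.
have qp : ~~ (q %| p)%N by rewrite dvdn_prime2 // eq_sym.
have dpq := divisor_poset_mul_pexp a (prime_gt0 pp) dp pq qp.
have n0 : (0 < p * q ^ a)%N by rewrite muln_gt0 expn_gt0 !prime_gt0.
move=> /(divisor_poset_eigenvalue 0 n0 dpq)/comparability_eigenvalueP[].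
- exact: divisor_poset_refl dpq.
- exact: divisor_poset_anti dpq.
move=> f [[x0 fx0] fA].
(* The values of the eigenfunction at q^k and at p q^k. *)
pose g (k : nat) := f (tt, false, inord k); pose h (k : nat) := f (tt, true, inord k).
have fg (i : 'I_a.+1) : f (tt, false, i) = g i by rewrite /g inord_val.
have fh (i : 'I_a.+1) : f (tt, true, i) = h i by rewrite /h inord_val.
have eqg i : (i <= a)%N -> \sum_(i <= k < a.+1) h k + \sum_(i <= k < a.+1) g k +
    \sum_(0 <= k < i.+1) g k = 2 * g i.
  move=> ia; have := fA (tt, false, inord i).
  rewrite add0r -/(g i) => <-; rewrite !sum_pair !sum_unit !big_bool /prod_le /=.
  rewrite inordK // -(sum_ord_ge _ i h) -(sum_ord_ge _ i g) -(@sum_ord_le a.+1 i g) //.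
  under [X in _ = _ + _ + (X + _)]eq_bigr do rewrite mul0r.
  rewrite big1_eq add0r.
  by congr (_ + _ + _); apply: eq_bigr => k _; rewrite ?fg ?fh.
have eqh i : (i <= a)%N -> \sum_(i <= k < a.+1) h k + \sum_(0 <= k < i.+1) h k +
    \sum_(0 <= k < i.+1) g k = 2 * h i.
  move=> ia; have := fA (tt, true, inord i).
  rewrite add0r -/(h i) => <-; rewrite !sum_pair !sum_unit !big_bool /prod_le /=.
  rewrite inordK // -(sum_ord_ge _ i h) -(@sum_ord_le a.+1 i h) // -(@sum_ord_le a.+1 i g) //.
  under [X in _ = (_ + X) + _]eq_bigr do rewrite mul0r.
  rewrite big1_eq addr0 addrA.
  by congr (_ + _ + _); apply: eq_bigr => k _; rewrite ?fg ?fh.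
(* Subtracting the equations at consecutive exponents leaves a linear recurrence. *)
have turn i : (i <= a)%N -> (g i, h i) = iter i hexagonal_turn (g 0%N, h 0%N).
  elim: i => [//|i IH] ia; rewrite iterS -IH 1?ltnW // /hexagonal_turn /=.
  have := eqg i (ltnW ia); have := eqg i.+1 ia.
  have := eqh i (ltnW ia); have := eqh i.+1 ia.
  rewrite !(@big_ltn _ _ _ i a.+1) 1?ltnW // !(big_nat_recr i.+1) //= => e1 e2 e3 e4.
  by congr pair; lra.
(* The equations at both ends of the chain close the system: for every residue of [a] other than 1
   they force [g 0] and [h 0], hence [f], to vanish. *)
have := eqg 0%N isT; have := eqh 0%N isT; have := eqg a (leqnn a); have := eqh a (leqnn a).
rewrite !big_nat1; set G := \sum_(0 <= k < _) g k; set H := \sum_(0 <= k < _) h k.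
have := turn a (leqnn a); rewrite iter_hexagonal_turn.
have [a6|a6] := eqVneq (a %% 6)%N 1%N; first by rewrite a6.
move=> ta e1 e2 e3 e4; case/eqP: fx0.
have [g0 h0] : g 0%N = 0 /\ h 0%N = 0.
  have := ltn_pmod a (isT : (0 < 6)%N); move: ta a6.
  by case: (a %% 6)%N => [|[|[|[|[|[|//]]]]]] //= [] *; split; lra.
have zero i : (i <= a)%N -> g i = 0 /\ h i = 0.
  move=> ia; have := turn i ia; rewrite g0 h0.
  have -> : iter i hexagonal_turn (0, 0) = (0, 0).
    by elim: i {ia} => //= i ->; rewrite /hexagonal_turn /= subr0.
  by case.
by case: x0 => -[[] []] i; [rewrite fh|rewrite fg]; have [] := zero i (ltn_ord i).
Qed.

End TwoPrimes.

Theorem theorem1p2 (R : realType) (n : nat) (n_gt0 : (0 < n)%N) :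
  (planar R (divisor_graph n) <->
     exists p q : nat, [/\ prime p, prime q, p <> q &
       n \in [:: 1; p; p ^ 2; p ^ 3; p * q; p ^ 2 * q]%N]) /\
  (forall p q : nat, prime p -> prime q -> p <> q -> gcdn n (p * q) = 1%N ->
     zpoly_dvd (graph_poly (divisor_graph n))
               (graph_poly (divisor_graph (n * p * q))) /\
     ((exists r : nat, [/\ prime r, (r %| n)%N & ~ (r ^ 2 %| n)%N]) ->
      zpoly_dvd (graph_poly (divisor_graph n) ^+ 2)
                (graph_poly (divisor_graph (n * p * q))))) /\
  ((2 <= n)%N -> graph_eigenvalue (divisor_graph n) (-1 : R)) /\
  (moebius n = -1 -> (2 <= Omega n)%N ->
     graph_eigenvalue (divisor_graph n) (-2 : R) /\
     graph_eigenvalue (divisor_graph n) (1 : R)) /\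
  (moebius n = 1 -> graph_eigenvalue (divisor_graph n) (0 : R)) /\
  (forall p q a : nat, prime p -> prime q -> p <> q -> (1 <= a)%N ->
     n = (p * q ^ a)%N ->
     (graph_eigenvalue (divisor_graph n) (0 : R) <-> a = 1 %[mod 6])) /\
  (forall p q a b : nat, prime p -> prime q -> p <> q ->
     (1 <= a)%N -> (1 <= b)%N -> n = (p ^ a * q ^ b)%N ->
     a = 1 %[mod 6] -> b = 1 %[mod 6] ->
     graph_eigenvalue (divisor_graph n) (0 : R)).

Proof.
split; [split|split; [|split; [|split; [|split; [|split]]]]].
- exact: planar_divisor_graph_form.
- move=> [p [q [pp pq /eqP npq]]]; have n_p2q := planar_divisor_graph_dvd R pp pq npq.
  (* All listed values except p^3 divide p^2 q. *)
  rewrite !inE => /or4P[/eqP->|/eqP->|/eqP->|/or3P[/eqP->|/eqP->|/eqP->]].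
  + exact/n_p2q/dvd1n.
  + by apply: n_p2q; rewrite -mulnA dvdn_mulr.
  + by apply: n_p2q; rewrite dvdn_mulr.
  + exact: planar_divisor_graph_cube.
  + by apply: n_p2q; rewrite -mulnA dvdn_mull.
  + exact: n_p2q.
- move=> p q pp pq /eqP npq cop.
  have [pn qn] : ~~ (p %| n)%N /\ ~~ (q %| n)%N.
    move/eqP: cop; rewrite -[_ == _]/(coprime n (p * q)) coprimeMr.
    by rewrite ![coprime n _]coprime_sym !prime_coprime // => /andP[].
  split=> [|[r [pr rn r2n]]]; first exact: divisor_graph_poly_dvd.
  (* Splitting off [r], which occurs only once, displays the chain of length 2 that yields the
     second embedding. *)
  have [m nE] := dvdnP rn; rewrite {n rn}nE in n_gt0 cop pn qn r2n *.
  apply: divisor_graph_poly_sqr_dvd => //; first by move: n_gt0; rewrite muln_gt0 => /andP[].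
  by apply/negP => rm; apply: r2n; rewrite -mulnn dvdn_mul.
- exact: divisor_graph_eigenvalueN1.
- exact: moebiusN1_eigenvalue.
- exact: moebius1_eigenvalue.
- move=> p q a pp pq /eqP npq a0 nE; split=> [|a1]; rewrite nE.
    exact: divisor_graph_prime_pexp_eigenvalue.
  (* The converse is the case of exponents 1 and [a]. *)
  by rewrite -(expn1 p); apply: divisor_graph_two_primes_eigenvalue.
move=> p q a b pp pq /eqP npq a0 b0 -> a1 b1.
exact: divisor_graph_two_primes_eigenvalue.
Qed.
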